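(* Let $\mathfrak{G}=\mathfrak{G}_+\oplus\mathfrak{G}_-$ be a finite-dimensional differential $\mathbb{Z}/2\mathbb{Z}$-graded Lie superalgebra over $\mathbb{C}$ with differential $d$, where $\mathfrak{G}_+=\mathrm{Lie}\,G_+$ for a connected simply-connected complex linear algebraic group $G_+$, and let $\beta$ be an even nondegenerate invariant bilinear form on $\mathfrak{G}$ (in the sense given in the context). Let $\omega:=\beta|_{\mathfrak{G}_-}$ and consider $\mathfrak{G}_-$ as a symplectic vector space equipped with the symplectic form $\omega$. Then the gauge action of $G_+$ on $\mathfrak{G}_-$ is symplectic, and it is Hamiltonian with moment map $$\Phi:\ \mathfrak{G}_-\longrightarrow \mathfrak{G}_+^*\overset{\beta}{\simeq}\mathfrak{G}_+,\qquad x\longmapsto dx+\tfrac12[x,x].$$ More precisely, the differential of $\Phi$ at $x\in\mathfrak{G}_-$ is $\Phi'_x(y)=dy+[x,y]$; one has $\Phi'_x(\xi_a(x))=[a,\Phi(x)]$ for all $a\in\mathfrak{G}_+$, $x\in\mathfrak{G}_-$, so that $\Phi$ is $G_+$-equivariant; and $$\omega(\xi_a(x),y)=\beta\bigl(a,\Phi'_x(y)\bigr)\qquad\text{for all } a\in\mathfrak{G}_+,\ x,y\in\mathfrak{G}_-,$$ where $\xi_a(x)=[a,x]-da$. Thus, for an $\mathrm{Ad}\,G_+$-orbit $\mathbb{O}\subset\mathfrak{G}_+\simeq\mathfrak{G}_+^*$, the modular stack $\mathscr{M}(\mathfrak{G},\mathbb{O})$ is precisely the Hamiltonian reduction of $\mathfrak{G}_-$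 with respect to the orbit $\mathbb{O}$.
   Context: A differential $\mathbb{Z}/2\mathbb{Z}$-graded Lie superalgebra is a Lie superalgebra $\mathfrak{G}=\mathfrak{G}_+\oplus\mathfrak{G}_-$ (even part $\mathfrak{G}_+$, odd part $\mathfrak{G}_-$) with an odd derivation $d:\mathfrak{G}_\pm\to\mathfrak{G}_\mp$, $d^2=0$. An even nondegenerate invariant bilinear form on $\mathfrak{G}$ is a $\mathbb{C}$-bilinear form $\beta:\mathfrak{G}\times\mathfrak{G}\to\mathbb{C}$ that is symmetric on $\mathfrak{G}_+$, skew-symmetric on $\mathfrak{G}_-$, with $\mathfrak{G}_+\perp\mathfrak{G}_-$, such that for all homogeneous $x,y,z\in\mathfrak{G}$ one has $\beta(dx,y)+(-1)^{\deg x}\beta(x,dy)=0$ and $\beta([x,y],z)=\beta(x,[y,z])$, and which is nondegenerate in the following sense: the morphism $\kappa:\mathfrak{G}\to\mathfrak{G}^*$, $x\mapsto\beta(x,-)$, of differential graded vector spaces (where $\mathfrak{G}^*$ carries the differential dual to $d$) induces an isomorphism on cohomology. For $a\in\mathfrak{G}_+$ let $\xi_a$ be the affine-linear vector field on $\mathfrak{G}_-$ with value $\xi_a(x)=[a,x]-da$ at $x$. The map $a\mapsto\xi_a$ is a Lie algebra homomorphism; exponentiating these vector fields gives an action of $G_+$ on $\mathfrak{G}_-$ by affine-linear transformations, called the gauge action. For an $\mathrm{Ad}\,G_+$-orbit $\mathbb{O}\subset\mathfrak{G}_+$, the Maurer-Cartan scheme is the locally closed subscheme $\mathsf{MC}(\mathfrak{G},\mathbb{O})=\{x\in\mathfrak{G}_-\mid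 dx+\frac12[x,x]\in\mathbb{O}\}$ of $\mathfrak{G}_-$. It is stable under the gauge action, and the modular stack $\mathscr{M}(\mathfrak{G},\mathbb{O}):=\mathsf{MC}(\mathfrak{G},\mathbb{O})/G_+$ is its stack quotient by the gauge action. The Hamiltonian reduction of $\mathfrak{G}_-$ with respect to $\mathbb{O}$ is the quotient $\Phi^{-1}(\mathbb{O})/G_+$.
   Formalization: The gauge action is assumed algebraic in the modular stack claim, since its exponentiation may be only holomorphic; that ω is symplectic and that β identifies the even part with its dual are premises of the clauses needing them, as nondegeneracy on cohomology does not imply them. *)

(* Defs.v *)
From HB Require Import structures.
From mathcomp Require Import all_boot all_order all_algebra.
From mathcomp Require Import complex.
From mathcomp Require Import all_classical all_reals all_analysis.
From mathcomp Require Import -(notations) mpoly.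

Set Implicit Arguments.
Unset Strict Implicit.
Unset Printing Implicit Defensive.

Import Order.TTheory GRing.Theory Num.Theory.
Import numFieldNormedType.Exports.
Import passmx.

Local Open Scope classical_set_scope.
Local Open Scope ring_scope.

(* The boolean index is the parity: [part false] is the even part and
   [part true] the odd part. The bracket is curried: [br x] is ad x. *)
Record dgLieSuper (K : fieldType) (L : vectType K) := DgLieSuper {
  part : bool -> {vspace L};
  br : 'Hom(L, 'End(L));
  dif : 'End(L);
  part_cap : (part false :&: part true)%VS = 0%VS;
  part_sum : (part false + part true)%VS = fullv;
  br_part : forall a b x y,
    x \in part a -> y \in part b -> br x y \in part (a (+) b);
  br_skew : forall a b x y,
    x \in part a -> y \in part b ->
    br x y = - ((-1) ^+ (a && b) *: br y x);
  br_jacobi : forall a b c x y z,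
    x \in part a -> y \in part b -> z \in part c ->
    br x (br y z) = br (br x y) z + (-1) ^+ (a && b) *: br y (br x z);
  dif_part : forall a x, x \in part a -> dif x \in part (~~ a);
  dif_dif : forall x, dif (dif x) = 0;
  dif_br : forall a b x y,
    x \in part a -> y \in part b ->
    dif (br x y) = br (dif x) y + (-1) ^+ a *: br x (dif y)
}.

(* A chain map inducing a bijection ker dV / im dV -> ker dW / im dW. *)
Definition quasi_iso (V W : zmodType) (dV : V -> V) (dW : W -> W)
    (f : V -> W) : Prop :=
  [/\ forall x, f (dV x) = dW (f x),
      forall x, dV x = 0 -> (exists w, f x = dW w) -> exists v, x = dV v &
      forall w, dW w = 0 ->
        exists x, dV x = 0 /\ exists w', w - f x = dW w'].

Section Parts.
Context {K : fieldType} {L : vectType K}.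
Implicit Types (g : dgLieSuper L) (beta : 'Hom(L, 'Hom(L, K^o))).

(* x |-> (-1)^(deg x) x *)
Definition parity_inv g : 'End(L) :=
  (daddv_pi (part g false) (part g true)
   - daddv_pi (part g true) (part g false))%R.

(* The differential of the dual complex, with the Koszul sign
   (d^* phi)(x) = - (-1)^(deg phi) phi (d x) = (-1)^(deg x) phi (d x). *)
Definition dual_dif g (phi : 'Hom(L, K^o)) : 'Hom(L, K^o) :=
  (phi \o dif g \o parity_inv g)%VF.

(* The form is curried: [beta] itself is the map kappa : L -> L^*.
   Nondegeneracy is only required on cohomology. *)
Record even_invariant_form g beta : Prop := EvenInvariantForm {
  form_sym : forall x y, x \in part g false -> y \in part g false ->
    beta x y = beta y x;
  form_skew : forall x y, x \in part g true -> y \in part g true ->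
    beta x y = - beta y x;
  form_orth : forall x y, x \in part g false -> y \in part g true ->
    beta x y = 0 /\ beta y x = 0;
  form_dif : forall a b x y, x \in part g a -> y \in part g b ->
    beta (dif g x) y + (-1) ^+ a * beta x (dif g y) = 0;
  form_br : forall a b c x y z,
    x \in part g a -> y \in part g b -> z \in part g c ->
    beta (br g x y) z = beta x (br g y z);
  form_nondeg : quasi_iso (dif g) (dual_dif g) beta
}.

Definition hpart g (a : bool) : vectType K := subvs_of (part g a).

Definition hdif g a : 'Hom(hpart g a, hpart g (~~ a)) :=
  linfun (fun x : hpart g a => vsproj (part g (~~ a)) (dif g (vsval x))).

Definition hbr g a b : 'Hom(hpart g a, 'Hom(hpart g b, hpart g (a (+) b))) :=
  linfun (fun x : hpart g a => linfun (fun y : hpart g b =>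
    vsproj (part g (a (+) b)) (br g (vsval x) (vsval y)))).

Definition hform g beta a : 'Hom(hpart g a, 'Hom(hpart g a, K^o)) :=
  linfun (fun x : hpart g a => linfun (fun y : hpart g a =>
    beta (vsval x) (vsval y) : K^o)).

(* [linfun] and [vsproj] are total, with junk values off linear maps and off the
   subspace; [hdifE], [hbrE] and [hformE] show that none occurs here. *)
Lemma linfun_lin (U V : vectType K) (f : U -> V) :
  linear f -> linfun f =1 f.
Proof.
move=> lin x.
pose h := GRing.isLinear.Build _ _ _ _ _ lin.
pose F : {linear U -> V} := HB.pack f h.
exact: (lfunE F).
Qed.

Lemma hdifE g a (x : hpart g a) : vsval (hdif g a x) = dif g (vsval x).
Proof.
rewrite /hdif linfun_lin; last by move=> c u v; rewrite !linearP.
by rewrite vsprojK //; apply: dif_part; exact: subvsP.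
Qed.

Lemma hbrE g a b (x : hpart g a) (y : hpart g b) :
  vsval (hbr g a b x y) = br g (vsval x) (vsval y).
Proof.
have lin2 (u : hpart g a) : linear (fun y : hpart g b =>
    vsproj (part g (a (+) b)) (br g (vsval u) (vsval y))).
  by move=> c v w; rewrite !linearP.
rewrite /hbr linfun_lin; last first.
  move=> c u v; apply/lfunP => w.
  by rewrite add_lfunE scale_lfunE !linfun_lin // !linearP /= add_lfunE
    scale_lfunE !linearP.
by rewrite linfun_lin // vsprojK //; apply: br_part; exact: subvsP.
Qed.

Lemma hformE g beta a (x y : hpart g a) :
  hform g beta a x y = beta (vsval x) (vsval y).
Proof.
have lin2 (u : hpart g a) : linear (fun y : hpart g a =>
    beta (vsval u) (vsval y) : K^o).
  by move=> c v w; rewrite !linearP.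
rewrite /hform linfun_lin; last first.
  move=> c u v; apply/lfunP => w.
  by rewrite add_lfunE scale_lfunE !linfun_lin // !linearP /= add_lfunE
    scale_lfunE.
by rewrite linfun_lin.
Qed.

End Parts.

(* R[i] seen through the abstract structure, so that the canonical topology of
   a numFieldType is inferred. *)
Definition Cplx (R : realType) : numClosedFieldType := R[i].

Section Coordinates.
Context {K : fieldType}.

Definition rv {V : vectType K} (x : V) : 'rV[K]_(\dim {:V}) :=
  rVof (vbasis {:V}) x.
Definition vec {V : vectType K} (x : 'rV[K]_(\dim {:V})) : V :=
  vecof (vbasis {:V}) x.

End Coordinates.

Section Analysis.
Context {R : realType}.
Local Notation C := (Cplx R).

(* Frechet differential of a map between finite-dimensional spaces, these
   carrying the topology of C^n through coordinates. *)
Definition has_differential (V W : vectType C) (f : V -> W) (x : V)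
    (df : 'Hom(V, W)) : Prop :=
  is_diff (rv x) (rv \o f \o vec) (rv \o df \o vec).

Definition expmx n (A : 'M[C]_n) : 'M[C]_n :=
  limn (series (fun k => (k`!%:R : C)^-1 *: A ^+ k)).

(* The time t is complex: the curve is holomorphic. *)
Definition integral_curve (V : vectType C) (xi : V -> V) (c : C -> V) : Prop :=
  forall t : C, is_derive t (1 : C) (rv \o c) (rv (xi (c t))).

(* Connected with contractible loops, for the topology of T. The sets S of
   interest are complex algebraic groups, which are locally path connected, so
   that connectedness amounts to path connectedness. *)
Definition simply_connected (T : topologicalType) (S : set T) : Prop :=
  connected S /\
  forall c : R -> T,
    {within `[0, 1]%classic, continuous c} -> c @` `[0, 1]%classic `<=` S -> c 0 = c 1 ->
    exists H : R * R -> T,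
      [/\ {within `[0, 1]%classic `*` `[0, 1]%classic, continuous H},
          H @` (`[0, 1]%classic `*` `[0, 1]%classic) `<=` S,
          (forall t, 0 <= t <= 1 -> H (0, t) = c t),
          (forall t, 0 <= t <= 1 -> H (1, t) = c 0) &
          (forall s, 0 <= s <= 1 -> H (s, 0) = c 0 /\ H (s, 1) = c 0)].

End Analysis.

Arguments simply_connected R {T} S.

Section AlgebraicGroups.
Context {R : realType}.
Local Notation C := (Cplx R).

(* Functions on matrices are polynomials in the n * n entries. *)
Definition mxpt (A : comNzRingType) n (g : 'M[A]_n) : 'I_(n * n) -> A :=
  fun k => mxvec g 0 k.

Definition mx_ideal n (G : set 'M[C]_n) : set (mpoly (n * n) C) :=
  [set p | forall g, G g -> meval (mxpt g) p = 0].

Record linear_algebraic_group n (G : set 'M[C]_n) : Prop := {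
  lag_closed : exists I : set (mpoly (n * n) C),
    G = [set g | g \in unitmx /\ forall p, I p -> meval (mxpt g) p = 0];
  lag_one : G 1%:M;
  lag_mul : forall g h, G g -> G h -> G (g *m h);
  lag_inv : forall g, G g -> G (invmx g)
}.

(* The Zariski tangent space at 1. *)
Definition lie_algebra n (G : set 'M[C]_n) : set 'M[C]_n :=
  [set X | forall p, mx_ideal G p ->
     \sum_k meval (mxpt 1%:M) (mderiv k p) * mxpt X k = 0].

(* [lam] identifies the even part, with its bracket, with Lie G. *)
Record lie_algebra_iso (L : vectType C) (g : dgLieSuper L) n
    (G : set 'M[C]_n) (lam : 'Hom(hpart g false, 'M[C]_n)) : Prop := {
  lie_inj : lker lam = 0%VS;
  lie_img : forall X, lie_algebra G X <-> X \in limg lam;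
  lie_br : forall a b, lam (hbr g false false a b) =
    lam a *m lam b - lam b *m lam a
}.

End AlgebraicGroups.

Section Gauge.
Context {R : realType}.
Local Notation C := (Cplx R).
Context {L : vectType C} (g : dgLieSuper L) (beta : 'Hom(L, 'Hom(L, C^o))).
Context {n : nat} (G : set 'M[C]_n) (lam : 'Hom(hpart g false, 'M[C]_n)).
Local Notation ev := (hpart g false).
Local Notation od := (hpart g true).

Definition xi (a : ev) (x : od) : od := hbr g false true a x - hdif g false a.

Definition Ad (u : 'M[C]_n) (a : ev) : ev :=
  (lam^-1)%VF (u *m lam a *m invmx u).

Definition Ad_orbit (O : set ev) : Prop :=
  exists a, O = [set b | exists2 u, G u & b = Ad u a].

Definition coAd_orbit (O : set 'Hom(ev, C^o)) : Prop :=
  exists phi : 'Hom(ev, C^o), O =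
    [set psi | exists2 u, G u & forall b, psi (Ad u b) = phi b].

(* The action of G obtained by exponentiating the xi_a; the values of rho
   outside of G are irrelevant. *)
Record gauge_action (rho : 'M[C]_n -> od -> od) : Prop := {
  gauge_one : forall x, rho 1%:M x = x;
  gauge_mul : forall u v x, G u -> G v -> rho (u *m v) x = rho u (rho v x);
  gauge_affine : forall u, G u ->
    exists (A : 'End(od)) (v : od), forall x, rho u x = A x + v;
  gauge_exp : forall (a : ev) (x : od),
    integral_curve (xi a) (fun t => rho (expmx (t *: lam a)) x)
}.

Definition omega : 'Hom(od, 'Hom(od, C^o)) := hform g beta true.
Definition kappa_ev : 'Hom(ev, 'Hom(ev, C^o)) := hform g beta false.

Definition Phi (x : od) : ev :=
  hdif g true x + 2^-1 *: hbr g true true x x.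

Definition dPhi (x : od) : 'Hom(od, ev) := (hdif g true + hbr g true true x)%R.

Definition mu (x : od) : 'Hom(ev, C^o) := kappa_ev (Phi x).

Definition MC (O : set ev) : set od :=
  [set x | O (hdif g true x + 2^-1 *: hbr g true true x x)].

End Gauge.

Arguments xi {R L} g a x.
Arguments Phi {R L} g x.
Arguments dPhi {R L} g x.
Arguments mu {R L} g beta x.
Arguments MC {R L} g O.

Section Symplectic.
Context {R : realType}.
Local Notation C := (Cplx R).

Definition symplectic_form (V : vectType C) (w : 'Hom(V, 'Hom(V, C^o))) : Prop :=
  (forall x, w x x = 0) /\ lker w = 0%VS.

(* f^* w = w for the constant 2-form w on V *)
Definition symplectic_map (V : vectType C) (w : 'Hom(V, 'Hom(V, C^o)))
    (f : V -> V) : Prop :=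
  forall x, exists2 df : 'End(V), has_differential f x df &
    forall y z, w (df y) (df z) = w y z.

(* Neither [symplectic_map] nor [moment_map] needs w nondegenerate.
   [m] is a moment map for an action [rho] of G with infinitesimal generators
   [zeta a]: d<m, a> = w (zeta a, -), and m intertwines [rho] with the coadjoint
   action. *)
Definition moment_map (V ga : vectType C) (w : 'Hom(V, 'Hom(V, C^o)))
    (T : Type) (G : set T) (ad : T -> ga -> ga) (rho : T -> V -> V)
    (zeta : ga -> V -> V) (m : V -> 'Hom(ga, C^o)) : Prop :=
  (forall x, exists2 dm : 'Hom(V, 'Hom(ga, C^o)), has_differential m x dm &
     forall a y, dm y a = w (zeta a x) y) /\
  (forall u x b, G u -> m (rho u x) (ad u b) = m x b).

End Symplectic.

Section Stacks.
Context {R : realType}.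
Local Notation C := (Cplx R).
Local Notation alg := (comUnitAlgType C).

(* A-points of the affine space underlying V, i.e. the module V (x) A *)
Definition apts (V : vectType C) (A : alg) : Type := 'rV[A]_(\dim {:V}).

Definition lin_pts (V W : vectType C) (f : 'Hom(V, W)) (A : alg)
    (x : apts V A) : apts W A :=
  x *m map_mx (in_alg A) (mxof (vbasis {:V}) (vbasis {:W}) f).

Definition bil_pts (V W Z : vectType C) (b : 'Hom(V, 'Hom(W, Z))) (A : alg)
    (x : apts V A) (y : apts W A) : apts Z A :=
  \sum_i \sum_j (x 0 i * y 0 j) *:
    map_mx (in_alg A) (rv (b (vbasis {:V})`_i (vbasis {:W})`_j)).

Definition evalA N (A : alg) (pt : 'I_N -> A) (p : mpoly N C) : A :=
  mmap (in_alg A) pt p.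

Definition van_ideal (V : vectType C) (S : set V) : set (mpoly (\dim {:V}) C) :=
  [set p | forall v, S v -> meval (fun k => rv v 0 k) p = 0].

Definition zclosure (V : vectType C) (S : set V) : set V :=
  [set v | forall p, van_ideal S p -> meval (fun k => rv v 0 k) p = 0].

(* A-points of the reduced subscheme of V on a Zariski locally closed set S:
   all functions vanishing on S vanish at y, and those vanishing on
   (closure of S) \ S generate the unit ideal at y. *)
Definition lc_pts (V : vectType C) (S : set V) (A : alg) : set (apts V A) :=
  [set y | (forall p, van_ideal S p -> evalA (fun k => y 0 k) p = 0) /\
     exists s : seq (A * mpoly (\dim {:V}) C),
       (forall c, c \in s -> van_ideal (zclosure S `\` S) c.2) /\
       \sum_(c <- s) c.1 * evalA (fun k => y 0 k) c.2 = 1].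

Definition grp_pts n (G : set 'M[C]_n) (A : alg) : set 'M[A]_n :=
  [set u | u \in unitmx /\
           forall p, mx_ideal G p -> evalA (mxpt u) p = 0].

(* An action of G on V by affine-linear maps whose coefficients are regular
   functions on G, i.e. polynomials in the entries of u and of u^-1. *)
Record regular_action (n : nat) (V : vectType C) := RegularAction {
  ra_lin : 'M[mpoly (n * n + n * n) C]_(\dim {:V});
  ra_trans : 'rV[mpoly (n * n + n * n) C]_(\dim {:V})
}.

Definition ra_pts n V (r : regular_action n V) (A : alg) (u : 'M[A]_n)
    (x : apts V A) : apts V A :=
  let e := evalA (fun k => row_mx (mxvec u) (mxvec (invmx u)) 0 k) in
  x *m map_mx e (ra_lin r) + map_mx e (ra_trans r).

Definition regular_for n V (r : regular_action n V) (G : set 'M[C]_n)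
    (rho : 'M[C]_n -> V -> V) : Prop :=
  forall u x, G u -> rv (rho u x) = ra_pts r (A := C^o) u (rv x).

(* A topology on affine C-schemes, given by its covering families. *)
Definition coverage := forall (A : alg) (I : Type) (B : I -> alg),
  (forall i, {lrmorphism A -> B i}) -> Prop.

(* A G-torsor over Spec A for the topology [cov]: a sheaf of sets on A-algebras
   with a simply transitive action of G, having sections locally. *)
Record torsor (cov : coverage) n (G : set 'M[C]_n) (A : alg) := Torsor {
  sec : forall B : alg, {lrmorphism A -> B} -> Type;
  res : forall (B B' : alg) (f : {lrmorphism A -> B})
    (f' : {lrmorphism A -> B'}) (h : {lrmorphism B -> B'}),
    h \o f =1 f' -> sec f -> sec f';
  act : forall (B : alg) (f : {lrmorphism A -> B}),
    'M[B]_n -> sec f -> sec f;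
  res_id : forall (B : alg) (f : {lrmorphism A -> B})
    (h : {lrmorphism B -> B}) (e : h \o f =1 f) (s : sec f),
    h =1 id -> res e s = s;
  res_comp : forall (B B' B'' : alg) (f : {lrmorphism A -> B})
    (f' : {lrmorphism A -> B'}) (f'' : {lrmorphism A -> B''})
    (h : {lrmorphism B -> B'}) (h' : {lrmorphism B' -> B''})
    (k : {lrmorphism B -> B''}) (e : h \o f =1 f') (e' : h' \o f' =1 f'')
    (e'' : k \o f =1 f'') (s : sec f),
    h' \o h =1 k -> res e'' s = res e' (res e s);
  act_one : forall (B : alg) (f : {lrmorphism A -> B}) (s : sec f),
    act 1%:M s = s;
  act_mul : forall (B : alg) (f : {lrmorphism A -> B}) u v (s : sec f),
    grp_pts G u -> grp_pts G v -> act (u *m v) s = act u (act v s);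
  act_res : forall (B B' : alg) (f : {lrmorphism A -> B})
    (f' : {lrmorphism A -> B'}) (h : {lrmorphism B -> B'})
    (e : h \o f =1 f') u (s : sec f),
    grp_pts G u -> res e (act u s) = act (map_mx h u) (res e s);
  act_simply_transitive : forall (B : alg) (f : {lrmorphism A -> B})
    (s s' : sec f), exists! u, grp_pts G u /\ act u s = s';
  locally_inhabited : exists (I : Type) (B : I -> alg)
    (f : forall i, {lrmorphism A -> B i}),
    cov A I B f /\ forall i, inhabited (sec (f i));
  glue : forall (B : alg) (f : {lrmorphism A -> B}) (I : Type) (D : I -> alg)
    (c : forall i, {lrmorphism B -> D i})
    (f' : forall i, {lrmorphism A -> D i}) (e : forall i, c i \o f =1 f' i)
    (s : forall i, sec (f' i)),
    cov B I D c ->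
    (forall i j (E : alg) (p : {lrmorphism D i -> E})
       (q : {lrmorphism D j -> E}) (k : {lrmorphism A -> E})
       (ep : p \o f' i =1 k) (eq : q \o f' j =1 k),
       p \o c i =1 q \o c j -> res ep (s i) = res eq (s j)) ->
    exists! t : sec f, forall i, res (e i) t = s i
}.

(* Objects over A and arrows over A -> A' of a category fibered over affine
   C-schemes. *)
Record fibered := Fibered {
  fob : alg -> Type;
  farr : forall A A' : alg, {lrmorphism A -> A'} -> fob A -> fob A' -> Type;
  fid : forall (A : alg) (P : fob A), farr idfun P P;
  fcomp : forall (A A' A'' : alg) (h : {lrmorphism A -> A'})
    (h' : {lrmorphism A' -> A''}) (P : fob A) (P' : fob A') (P'' : fob A''),
    farr h P P' -> farr h' P' P'' -> farr (h' \o h) P P''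
}.

Section Quotient.
Context (cov : coverage) (n : nat) (G : set 'M[C]_n) (V : vectType C).
Context (r : regular_action n V) (X : forall A : alg, set (apts V A)).

(* An object of the quotient stack [X / G] over A, for a subscheme X of V: a G-torsor P over
   Spec A with a G-equivariant morphism P -> X. *)
Record quo_ob (A : alg) := QuoOb {
  qtors :> torsor cov G A;
  qmap : forall (B : alg) (f : {lrmorphism A -> B}), sec qtors f -> apts V B;
  qmap_in : forall (B : alg) (f : {lrmorphism A -> B}) (s : sec qtors f),
    X (qmap s);
  qmap_res : forall (B B' : alg) (f : {lrmorphism A -> B})
    (f' : {lrmorphism A -> B'}) (h : {lrmorphism B -> B'})
    (e : h \o f =1 f') (s : sec qtors f),
    qmap (res e s) = map_mx h (qmap s);
  qmap_act : forall (B : alg) (f : {lrmorphism A -> B}) u (s : sec qtors f),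
    grp_pts G u -> qmap (act u s) = ra_pts r u (qmap s)
}.

(* An arrow over h : A -> A': an isomorphism of P' with the restriction of P
   to A'-algebras, compatible with the morphisms to X. (A G-equivariant
   morphism of torsors is an isomorphism.) *)
Record quo_arr (A A' : alg) (h : {lrmorphism A -> A'})
    (P : quo_ob A) (P' : quo_ob A') := QuoArr {
  amap : forall (B : alg) (f : {lrmorphism A -> B})
    (f' : {lrmorphism A' -> B}), f' \o h =1 f -> sec P' f' -> sec P f;
  amap_res : forall (B D : alg) (f : {lrmorphism A -> B})
    (f' : {lrmorphism A' -> B}) (k : {lrmorphism A -> D})
    (k' : {lrmorphism A' -> D}) (c : {lrmorphism B -> D})
    (ef : f' \o h =1 f) (ek : k' \o h =1 k) (e : c \o f =1 k)
    (e' : c \o f' =1 k') (s : sec P' f'),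
    amap ek (res e' s) = res e (amap ef s);
  amap_act : forall (B : alg) (f : {lrmorphism A -> B})
    (f' : {lrmorphism A' -> B}) (ef : f' \o h =1 f) u (s : sec P' f'),
    grp_pts G u -> amap ef (act u s) = act u (amap ef s);
  amap_qmap : forall (B : alg) (f : {lrmorphism A -> B})
    (f' : {lrmorphism A' -> B}) (ef : f' \o h =1 f) (s : sec P' f'),
    qmap (amap ef s) = qmap s
}.

Definition quo_id (A : alg) (P : quo_ob A) : quo_arr idfun P P.
Proof.
exists (fun (B : alg) (f f' : {lrmorphism A -> B}) (e : f' \o idfun =1 f)
    (s : sec P f') =>
  @res _ _ _ _ P B B f' f (idfun : {lrmorphism B -> B}) e s).
- move=> B D f f' k k' c ef ek e e' s.
  have e2 : c \o f' =1 k by move=> a; rewrite e' -[RHS]ek.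
  rewrite -(res_comp (k := c) (h := c) e' _ e2) //.
  by rewrite -(res_comp (k := c) (h' := c) _ e e2).
- by move=> B f f' ef u s Gu; rewrite act_res // map_mx_id.
- by move=> B f f' ef s; rewrite qmap_res map_mx_id.
Defined.

Definition quo_comp (A A' A'' : alg) (h : {lrmorphism A -> A'})
    (h' : {lrmorphism A' -> A''}) (P : quo_ob A) (P' : quo_ob A')
    (P'' : quo_ob A'') (a : quo_arr h P P') (a' : quo_arr h' P' P'') :
  quo_arr (h' \o h) P P''.
Proof.
exists (fun (B : alg) (f : {lrmorphism A -> B}) (f'' : {lrmorphism A'' -> B})
    (e : f'' \o (h' \o h) =1 f) (s : sec P'' f'') =>
  amap a (f' := (f'' \o h' : {lrmorphism A' -> B})) e
    (amap a' (fun=> erefl) s)).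
- move=> B D f f'' k k'' c ef ek e e'' s.
  have e' : c \o (f'' \o h') =1 k'' \o h' by move=> x; exact: e''.
  rewrite (amap_res a' (f := f'' \o h') (k := k'' \o h')
    (fun=> erefl) (fun=> erefl) e' e'').
  exact: amap_res.
- by move=> B f f'' ef u s Gu; rewrite !amap_act.
- by move=> B f f'' ef s; rewrite !amap_qmap.
Defined.

(* The quotient stack [X / G]; X is meant to be stable under the action r. *)
Definition stack_quotient : fibered :=
  {| fob := quo_ob; farr := quo_arr; fid := quo_id; fcomp := quo_comp |}.

End Quotient.

Definition Phi_pts (L : vectType C) (g : dgLieSuper L) (A : alg)
    (x : apts (hpart g true) A) : apts (hpart g false) A :=
  lin_pts (hdif g true) x
  + in_alg A 2^-1 *: bil_pts (hbr g true true) x x.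

Definition mu_pts (L : vectType C) (g : dgLieSuper L)
    (beta : 'Hom(L, 'Hom(L, C^o))) (A : alg) (x : apts (hpart g true) A) :
    apts 'Hom(hpart g false, C^o) A :=
  lin_pts (kappa_ev g beta) (Phi_pts x).

(* [MC(g, O) / G], with MC(g, O) the scheme of x with dx + [x, x] / 2 in O;
   O is locally closed, and carries the reduced structure. *)
Definition modular_stack (cov : coverage) (L : vectType C) (g : dgLieSuper L)
    (n : nat) (G : set 'M[C]_n) (r : regular_action n (hpart g true))
    (O : set (hpart g false)) : fibered :=
  stack_quotient cov G r (fun A => [set x | lc_pts O
    (lin_pts (hdif g true) x
     + in_alg A 2^-1 *: bil_pts (hbr g true true) x x)]).

(* [m^-1(S) / G], for the scheme-theoretic preimage of S under m : V -> W *)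
Definition hamiltonian_reduction (cov : coverage) (V W : vectType C) (n : nat)
    (G : set 'M[C]_n) (r : regular_action n V)
    (m : forall A : alg, apts V A -> apts W A) (S : set W) : fibered :=
  stack_quotient cov G r (fun A => [set x | lc_pts S (m A x)]).

End Stacks.

Arguments Phi_pts {R L} g A x.
Arguments mu_pts {R L} g beta A x.
Arguments modular_stack {R} cov {L} g {n} G r O.
Arguments hamiltonian_reduction {R} cov {V W n} G r m S.

(* Main.v *)
(* The vector fields [xi a] integrate to the gauge action, so the infinitesimal
   identities dPhi (xi a) = [a, Phi] and the ad-invariance of the form integrate
   along t |-> exp (t a); this gives equivariance and invariance for elements
   exp a of G, and they propagate to products. As [rho] is assumed neither
   continuous nor algebraic, G must be shown to consist of such products. Since G
   is connected, it is enough that a neighbourhood of 1 in G lies in exp (Lie G).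
   Write g = exp X with X small and X = Y + Z, with Y in Lie G and Z in a
   complement. Then exp (-Y) g = 1 + Z + o(Z) lies in G, but finitely many
   equations that cut out Lie G vanish to second order at 1 along G, and they
   bound Z from above; so Z = 0. That exp (Lie G) is contained in G follows from
   the stability of the ideal of G under the left-invariant derivations.
   For the stacks: when [kappa] is invertible, O and its image are the same locally
   closed subscheme up to a linear change of coordinates. *)

Require Import Defs.
From mathcomp Require Import all_boot all_order all_algebra.
From mathcomp Require Import complex ring lra.
From mathcomp Require Import all_classical all_reals all_analysis.
From mathcomp Require Import -(notations) mpoly.

Set Implicit Arguments.
Unset Strict Implicit.
Unset Printing Implicit Defensive.

Import Order.TTheory GRing.Theory Num.Theory.
Import numFieldNormedType.Exports.
Import passmx.

Local Open Scope classical_set_scope.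
Local Open Scope ring_scope.

(** * The entrywise norm and convergence of complex matrices *)

Section Modulus.
Context {R : realType}.
Local Notation C := (Cplx R).

(** The library norm on complex matrices takes complex values, so the estimates are made in the
    real-valued entrywise norm [nrm], and comparison lemmas translate them into the topology. No
    uniqueness theorem for differential equations is invoked: a solution is conjugated, or paired by
    an invariant form, into a curve with zero derivative, and such a curve takes equal values at 0
    and 1 by the real theorem applied to its real and imaginary parts. For exp (Lie G) inside G, it
    is not enough that all derivatives of p (exp (tX)) vanish at t = 0: Taylor's formula also needs
    a bound on them along [0, 1], and a geometric one is provided. The splitting X = Y + Z comes
    from a pseudo-inverse of the matrix of the finitely many equations of Lie G. It gives both the
    membership of Y in Lie G and a bound of Z by the values of the equations at Z. The stacks are
    compared by an equality of functors of points, so no equivalence of fibered categories has to be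
    built. *)

Definition cabs (z : C) : R := ComplexField.Normc.normc z.

Lemma normCE (z : C) : `|z| = (cabs z)%:C%C.
Proof. by []. Qed.

Lemma cabs0 : cabs 0 = 0.
Proof. exact: ComplexField.Normc.normc0. Qed.

Lemma cabs1 : cabs 1 = 1.
Proof. exact: ComplexField.Normc.normc1. Qed.

Lemma cabs0_eq0 z : cabs z = 0 -> z = 0.
Proof. exact: ComplexField.Normc.eq0_normc. Qed.

Lemma cabs_ge0 z : 0 <= cabs z.
Proof. by rewrite -ler0c -normCE normr_ge0. Qed.

Lemma cabsM z w : cabs (z * w) = cabs z * cabs w.
Proof. exact: ComplexField.Normc.normcM. Qed.

Lemma ler_cabsD z w : cabs (z + w) <= cabs z + cabs w.
Proof. exact: le_normcD. Qed.

Lemma cabsN z : cabs (- z) = cabs z.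
Proof. exact: normcN. Qed.

Lemma cabsX z k : cabs (z ^+ k) = cabs z ^+ k.
Proof. by elim: k => [|k IH]; rewrite ?expr0 ?cabs1 // !exprS cabsM IH. Qed.

Lemma cabs_real (x : R) : cabs (x%:C%C : C) = `|x|.
Proof. by rewrite /cabs /= expr0n /= addr0 sqrtr_sqr. Qed.

Lemma cabs_nat k : cabs (k%:R : C) = k%:R.
Proof.
by rewrite -(@rmorph_nat _ _ (real_complex R)) cabs_real ger0_norm.
Qed.

Lemma cabsV z : cabs z^-1 = (cabs z)^-1.
Proof. exact: ComplexField.Normc.normcV. Qed.

Lemma ler_cabs_sum (I : Type) (r : seq I) (P : pred I) (F : I -> C) :
  cabs (\sum_(i <- r | P i) F i) <= \sum_(i <- r | P i) cabs (F i).
Proof.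
elim/big_ind2 : _ => [|a b c d h1 h2|//]; first by rewrite cabs0.
by apply: le_trans (ler_cabsD _ _) _; exact: lerD.
Qed.

Lemma Re_le_cabs (z : C) : `|complex.Re z| <= cabs z.
Proof. by rewrite -lecR -normCE; exact: normc_ge_Re. Qed.

Lemma Im_le_cabs (z : C) : `|complex.Im z| <= cabs z.
Proof.
have := Re_le_cabs (z * 'i%C); rewrite ReiNIm normrN => /le_trans; apply.
by rewrite cabsM {2}/cabs /= expr0n /= add0r expr1n sqrtr1 mulr1.
Qed.

Lemma cabs_le_ReIm (z : C) :
  cabs z <= `|complex.Re z| + `|complex.Im z|.
Proof.
rewrite [in leLHS](complexE z); apply: le_trans (ler_cabsD _ _) _.
rewrite cabsM !cabs_real {1}/cabs /= expr0n /= add0r expr1n sqrtr1.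
by rewrite mul1r.
Qed.

Lemma pos_cplx (e : C) : 0 < e -> exists2 d : R, 0 < d & e = (d%:C)%C.
Proof.
rewrite ltcE /= => /andP[/eqP e0 e1]; exists (complex.Re e) => //.
by case: e e0 e1 => a b /= ->.
Qed.

End Modulus.

Section MatrixNorm.
Context {R : realType}.
Local Notation C := (Cplx R).

(** Preferred to the maximum norm because it is submultiplicative without a dimension factor. *)
Definition nrm m n (A : 'M[C]_(m, n)) : R := \sum_i \sum_j cabs (A i j).

Section Basic.
Context {m n : nat}.
Implicit Types A B : 'M[C]_(m, n).

Lemma nrm_ge0 A : 0 <= nrm A.
Proof. by apply: sumr_ge0 => i _; apply: sumr_ge0 => j _; exact: cabs_ge0. Qed.

Lemma cabs_le_nrm A i j : cabs (A i j) <= nrm A.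
Proof.
rewrite /nrm (bigD1 i) //= (bigD1 j) //= -addrA lerDl addr_ge0 //.
  by apply: sumr_ge0 => k _; exact: cabs_ge0.
by apply: sumr_ge0 => k _; apply: sumr_ge0 => l _; exact: cabs_ge0.
Qed.

Lemma nrm_le0 A : nrm A <= 0 -> A = 0.
Proof.
move=> A0; apply/matrixP => i j; rewrite mxE; apply: cabs0_eq0.
apply/eqP; rewrite eq_le cabs_ge0 andbT.
exact: le_trans (cabs_le_nrm _ _ _) A0.
Qed.

Lemma nrm0 : nrm (0 : 'M[C]_(m, n)) = 0.
Proof. by apply: big1 => i _; apply: big1 => j _; rewrite mxE cabs0. Qed.

Lemma ler_nrmD A B : nrm (A + B) <= nrm A + nrm B.
Proof.
rewrite /nrm -big_split /=; apply: ler_sum => i _.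
rewrite -big_split /=; apply: ler_sum => j _.
by rewrite mxE; exact: ler_cabsD.
Qed.

Lemma nrmN A : nrm (- A) = nrm A.
Proof. by apply: eq_bigr => i _; apply: eq_bigr => j _; rewrite mxE cabsN. Qed.

Lemma nrm_sym A B : nrm (A - B) = nrm (B - A).
Proof. by rewrite -opprB nrmN. Qed.

Lemma ler_nrmB A B : nrm (A - B) <= nrm A + nrm B.
Proof. by rewrite -(nrmN B); exact: ler_nrmD. Qed.

Lemma nrmZ c A : nrm (c *: A) = cabs c * nrm A.
Proof.
rewrite /nrm mulr_sumr; apply: eq_bigr => i _.
by rewrite mulr_sumr; apply: eq_bigr => j _; rewrite mxE cabsM.
Qed.

Lemma ler_nrm_sum (I : Type) (r : seq I) (P : pred I) (F : I -> 'M[C]_(m, n)) :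
  nrm (\sum_(i <- r | P i) F i) <= \sum_(i <- r | P i) nrm (F i).
Proof.
elim/big_ind2 : _ => [|a b c d h1 h2|//]; first by rewrite nrm0.
by apply: le_trans (ler_nrmD _ _) _; exact: lerD.
Qed.

Lemma normr_le_nrm A : `|A| <= ((nrm A)%:C)%C.
Proof.
suff h (x : C) : (x != 0 -> exists ij, x = `|A ij.1 ij.2|) ->
  x <= ((nrm A)%:C)%C by apply: h; exact: mx_norm_neq0.
have [->|x0] := eqVneq x 0; first by rewrite ler0c nrm_ge0.
by move=> /(_ isT)[ij ->]; rewrite normCE lecR cabs_le_nrm.
Qed.

End Basic.

Lemma ler_nrmM m n p (A : 'M[C]_(m, n)) (B : 'M[C]_(n, p)) :
  nrm (A *m B) <= nrm A * nrm B.
Proof.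
rewrite /nrm mulr_suml; apply: ler_sum => i _.
apply: (@le_trans _ _ (\sum_k \sum_j cabs (A i j) * cabs (B j k))).
  apply: ler_sum => k _; rewrite mxE.
  apply: le_trans (ler_cabs_sum _ _ _) _.
  by apply: ler_sum => j _; rewrite cabsM.
rewrite exchange_big /= mulr_suml; apply: ler_sum => j _.
rewrite -mulr_sumr; apply: ler_wpM2l; first exact: cabs_ge0.
rewrite [leRHS](bigD1 j) //= lerDl; apply: sumr_ge0 => k _.
by apply: sumr_ge0 => l _; exact: cabs_ge0.
Qed.

(** The identity has norm n rather than 1, which is why the exponent is a successor. *)
Lemma ler_nrmX n (A : 'M[C]_n) k : nrm (A ^+ k.+1) <= nrm A ^+ k.+1.
Proof.
elim: k => [//|k IH]; rewrite exprS [leRHS]exprS.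
by apply: le_trans (ler_nrmM _ _) _; rewrite ler_wpM2l // nrm_ge0.
Qed.

Lemma nrm1 n : nrm (1%:M : 'M[C]_n) = n%:R.
Proof.
transitivity (\sum_(i < n) (1 : R)).
  apply: eq_bigr => i _; rewrite (bigD1 i) //= big1 ?mxE ?eqxx ?cabs1 ?addr0 //.
  by move=> j ji; rewrite mxE eq_sym (negbTE ji) cabs0.
by rewrite sumr_const card_ord.
Qed.

Lemma nbhs_nrm m n (A : 'M[C]_(m, n)) (e : R) : 0 < e ->
  nbhs A [set B | nrm (B - A) < e].
Proof.
(* Each of the [m * n] entries contributes at most [d]; the successor makes the total strictly less
   than [e] and covers empty matrices. *)
move=> e0; set d := e / (m * n).+1%:R.
have d0 : 0 < d by rewrite divr_gt0.
apply/nbhs_ballP; exists ((d%:C)%C : C) => /=; first by rewrite ltcR.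
move=> B [_ AB] /=.
apply: (@le_lt_trans _ _ (\sum_(i < m) \sum_(j < n) d)).
  apply: ler_sum => i _; apply: ler_sum => j _; apply/ltW.
  by have := AB i j; rewrite /ball /= distrC normCE ltcR !mxE.
rewrite !sumr_const !card_ord -mulrnA.
rewrite -mulr_natr /d -mulrA gtr_pMr // mulrC ltr_pdivrMr ?ltr0n // mul1r.
by rewrite ltr_nat mulnC ltnS.
Qed.

Lemma nrm_nbhs m n (A : 'M[C]_(m, n)) (U : set 'M[C]_(m, n)) : nbhs A U ->
  exists2 e : R, 0 < e & forall B, nrm (B - A) < e -> U B.
Proof.
move=> /nbhs_ballP[e /= /pos_cplx[d d0 ->] h]; exists d => // B BA; apply: h.
rewrite -ball_normE /ball_ /= distrC.
by apply: le_lt_trans (normr_le_nrm _) _; rewrite ltcR.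
Qed.

(** Phrased through a real sequence so that squeeze and comparison arguments on reals apply;
    [mcvg_lim] recovers the topological limit used by [expmx]. *)
Definition mcvg m n (u : nat -> 'M[C]_(m, n)) (l : 'M[C]_(m, n)) : Prop :=
  (fun k => nrm (u k - l)) @ \oo --> (0 : R).

Lemma mcvg_lim m n (u : nat -> 'M[C]_(m, n)) l : mcvg u l -> limn u = l.
Proof.
move=> ul; apply: (cvg_lim (@norm_hausdorff C 'M[C]_(m, n))).
move=> U /nrm_nbhs[e e0 eU].
have : \forall k \near \oo, `|0 - nrm (u k - l)| < e.
  by move/cvgrPdist_lt : ul; apply.
rewrite !nearE; apply: filterS => k; rewrite sub0r normrN => h.
by apply: eU; exact: le_lt_trans (ler_norm _) h.
Qed.

(** Completeness is inherited from R: the real and imaginary parts of each entry telescope into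
    series dominated by [e], and the limit is assembled from theirs. *)
Lemma mcvg_exists m n (u : nat -> 'M[C]_(m, n)) (e : nat -> R) :
  (forall k, nrm (u k.+1 - u k) <= e k) -> cvgn (series e) ->
  exists l, mcvg u l.
Proof.
move=> ue ce.
have cauchy (x : nat -> R) : (forall k, `|x k.+1 - x k| <= e k) -> cvgn x.
  move=> xe; have ct : cvgn (series (telescope x)).
    apply: (@normed_cvg R R^o (telescope x)).
    apply: series_le_cvg ce => k //=; last exact: xe.
    by apply: le_trans (xe k); rewrite normr_ge0.
  rewrite (_ : x = fun k => x 0%N + series (telescope x) k).
    by apply: is_cvgD => //; exact: is_cvg_cst.
  by apply/funext => k; rewrite -eq_sum_telescope.
have cRe i j : cvgn (fun k => complex.Re (u k i j)).
  apply: cauchy => k; apply: le_trans (ue k).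
  apply: le_trans (cabs_le_nrm _ i j); rewrite !mxE.
  by apply: le_trans (Re_le_cabs _); case: (u k.+1 i j) => ? ?; case: (u k i j).
have cIm i j : cvgn (fun k => complex.Im (u k i j)).
  apply: cauchy => k; apply: le_trans (ue k).
  apply: le_trans (cabs_le_nrm _ i j); rewrite !mxE.
  by apply: le_trans (Im_le_cabs _); case: (u k.+1 i j) => ? ?; case: (u k i j).
exists (\matrix_(i, j) ((limn (fun k => complex.Re (u k i j)) +i*
                        limn (fun k => complex.Im (u k i j)))%C : C)).
pose b k : R := \sum_i \sum_j
  (`|complex.Re (u k i j) - limn (fun k => complex.Re (u k i j))| +
   `|complex.Im (u k i j) - limn (fun k => complex.Im (u k i j))|).
apply: (@squeeze_cvgr _ _ _ _ (cst 0) b).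
- near=> k; rewrite nrm_ge0 /=.
  apply: ler_sum => i _; apply: ler_sum => j _; rewrite !mxE.
  by apply: le_trans (cabs_le_ReIm _) _; case: (u k i j).
- exact: cvg_cst.
rewrite (_ : 0 = \sum_(i < m) \sum_(j < n) (0 + 0) :> R); last first.
  by rewrite big1 // => i _; rewrite big1 // => j _; rewrite addr0.
have dist0 (x : nat -> R) : cvgn x -> (fun k => `|x k - limn x|) @ \oo --> 0.
  move=> cx; rewrite -(normr0 R^o); apply: cvg_norm.
  by rewrite -(subrr (limn x)); apply: cvgB => //; exact: cvg_cst.
have cvg_sum_fun (I : finType) (f : I -> nat -> R) (a : I -> R) :
    (forall i, f i @ \oo --> a i) ->
    (fun k => \sum_i f i k) @ \oo --> \sum_i a i.
  move=> fa; rewrite (_ : (fun k => _) = \sum_i f i); last first.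
    by apply/funext => k; rewrite fct_sumE.
  elim/big_ind2 : _ => [|f1 a1 f2 a2 h1 h2|i _]; first exact: cvg_cst.
    exact: cvgD.
  exact: fa.
apply: (cvg_sum_fun) => i; apply: (cvg_sum_fun) => j.
by apply: cvgD; exact: dist0.
Unshelve. all: by end_near. Qed.

Lemma mcvg_le m n (u : nat -> 'M[C]_(m, n)) l a (b : R) : mcvg u l ->
  (forall k, nrm (u k - a) <= b) -> nrm (l - a) <= b.
Proof.
move=> ul ub; apply/ler_addgt0Pr => e e0.
have : \forall k \near \oo, `|0 - nrm (u k - l)| < e.
  by move/cvgrPdist_lt : ul; apply.
move=> [N _ /(_ N (leqnn _))] /=; rewrite sub0r normrN ger0_norm ?nrm_ge0 // => h.
rewrite -(subrKA (u N)) addrC; apply: le_trans (ler_nrmD _ _) _.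
by rewrite lerD // nrm_sym ltW.
Qed.

Lemma mcvg_cst m n (l : 'M[C]_(m, n)) : mcvg (fun=> l) l.
Proof.
rewrite /mcvg (_ : (fun _ => _) = cst 0); first exact: cvg_cst.
by apply/funext => k; rewrite subrr nrm0.
Qed.

Lemma mcvg_bounded m n (u : nat -> 'M[C]_(m, n)) l (d : nat -> R) :
  (forall k, nrm (u k - l) <= d k) -> d @ \oo --> 0 -> mcvg u l.
Proof.
move=> ud d0; apply: (@squeeze_cvgr _ _ _ _ (cst 0) d) => //.
  by near=> k; rewrite nrm_ge0 /=.
exact: cvg_cst.
Unshelve. all: by end_near. Qed.

Lemma mcvg_affine m n p q (f : 'M[C]_(m, n) -> 'M[C]_(p, q)) (K : R) u l :
  (forall A B, nrm (f A - f B) <= K * nrm (A - B)) ->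
  mcvg u l -> mcvg (fun k => f (u k)) (f l).
Proof.
move=> fK ul; apply: mcvg_bounded (fun k => fK (u k) l) _.
by rewrite -(mulr0 K); apply: cvgMl_tmp.
Qed.

Lemma mcvgD m n (u v : nat -> 'M[C]_(m, n)) l l' :
  mcvg u l -> mcvg v l' -> mcvg (fun k => u k + v k) (l + l').
Proof.
move=> ul vl; apply: (@mcvg_bounded _ _ _ _
  (fun k => nrm (u k - l) + nrm (v k - l'))).
  by move=> k; rewrite opprD addrACA ler_nrmD.
by rewrite -(addr0 0); exact: cvgD.
Qed.

Lemma mcvg_uniq m n (u : nat -> 'M[C]_(m, n)) l l' :
  mcvg u l -> mcvg u l' -> l = l'.
Proof. by move=> /mcvg_lim <- /mcvg_lim. Qed.

End MatrixNorm.

(** * The matrix exponential *)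

(** Applied with [o], [a], [b] equal to 1, A, B and [x], [y] the terms of degree at least two of the
    exponential sums: the constant and linear terms of (exp A - A) - (exp B - B) cancel. *)
Lemma cancel_leading1 (V : zmodType) (o a b x y : V) :
  o + (a + x) + (- (o + (b + y)) + (b - a)) = x - y.
Proof.
have -> : o + (a + x) = x + (o + a) by rewrite addrA addrC.
have -> : - (o + (b + y)) + (b - a) = - y - (o + a).
  rewrite !opprD (AC ((1*2)*2) ((3*(1*5))*(2*4)))%AC /=.
  by rewrite addNr addr0.
by rewrite addrACA subrr addr0.
Qed.

(** The same cancellation for exp ((t + h)X) - exp (tX) - hX exp (tX), with [a] = tX and [b] =
    hX. *)
Lemma cancel_leading2 (V : zmodType) (o a b x y z : V) :
  o + (a + b + x) - (o + (a + y) + (b + z)) = x - y - z.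
Proof.
have -> : o + (a + b + x) = x + (o + (a + b)) by rewrite addrA addrC.
have -> : o + (a + y) + (b + z) = (y + z) + (o + (a + b)).
  by rewrite (AC ((1*2)*2) ((3*5)*(1*(2*4))))%AC.
by rewrite opprD addrACA subrr addr0 opprD addrA.
Qed.

Lemma combine_scale (K : comNzRingType) (V : lmodType K) (c a b h d e : K) (v : V) :
  c *: (a *: v) - c *: (b *: v) - h *: (d *: (e *: v)) =
  (c * a - c * b - h * d * e) *: v.
Proof. by rewrite !scalerA !scalerBl. Qed.

Section Exponential.
Context {R : realType}.
Local Notation C := (Cplx R).

Lemma sum_exp_coeff_le (x : R) N : 0 <= x ->
  \sum_(0 <= k < N) x ^+ k / k`!%:R <= expR x.
Proof.
move=> x0; apply: (@nondecreasing_cvgn_le _ (series (exp_coeff x))).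
  by apply: nondecreasing_series => k _ _; exact: exp_coeff_ge0.
exact: is_cvg_series_exp_coeff.
Qed.

Lemma sum_exp_coeffS_le (x : R) N : 0 <= x ->
  \sum_(0 <= k < N) x ^+ k.+1 / k.+1`!%:R <= expR x - 1.
Proof.
move=> x0; rewrite lerBrDl; apply: le_trans (sum_exp_coeff_le N.+1 x0).
by rewrite [leRHS]big_nat_recl // expr0 fact0 divr1.
Qed.

Section Bounds.
Context {n : nat}.
Implicit Types X Y A B : 'M[C]_n.

Definition expsum X N : 'M[C]_n :=
  series (fun k => (k`!%:R : C)^-1 *: X ^+ k) N.

(** The factor accounts for [k = 0], where the left side is n; [n.+1] instead of [n] keeps it at
    least 1 for empty matrices. *)
Lemma nrmX_le X k : nrm (X ^+ k) <= n.+1%:R * nrm X ^+ k.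
Proof.
case: k => [|k]; first by rewrite !expr0 mulr1 nrm1 ler_nat.
apply: le_trans (ler_nrmX _ _) _; rewrite ler_peMl ?exprn_ge0 ?nrm_ge0 //.
by rewrite ler1n.
Qed.

Lemma expsumP X : mcvg (expsum X) (expmx X).
Proof.
have [||l Xl] := @mcvg_exists R n n (expsum X)
    (n.+1%:R *: exp_coeff (nrm X) : nat -> R).
- move=> k; rewrite /expsum seriesSB nrmZ cabsV cabs_nat.
  rewrite -[leRHS]/(n.+1%:R * (nrm X ^+ k / k`!%:R)) mulrA mulrC.
  by rewrite ler_wpM2r ?invr_ge0 // nrmX_le.
- by apply: is_cvg_seriesZ; exact: is_cvg_series_exp_coeff.
by rewrite /expmx (mcvg_lim Xl).
Qed.

Lemma expsumE X N : expsum X N = \sum_(0 <= k < N) (k`!%:R : C)^-1 *: X ^+ k.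
Proof. by []. Qed.

Lemma expsumS X N :
  expsum X N.+1 = 1 + \sum_(0 <= k < N) (k.+1`!%:R : C)^-1 *: X ^+ k.+1.
Proof. by rewrite expsumE big_nat_recl // fact0 invr1 scale1r expr0. Qed.

Lemma expsumSS X N : expsum X N.+2 =
  1 + (X + \sum_(0 <= k < N) (k.+2`!%:R : C)^-1 *: X ^+ k.+2).
Proof. by rewrite expsumS big_nat_recl // invr1 scale1r expr1. Qed.

Lemma expmx0 : expmx (0 : 'M[C]_n) = 1%:M.
Proof.
(* The partial sum with no term is 0, so the sequence is constant only after a shift by one. *)
have h : mcvg (fun k => expsum 0 k.+1) (1%:M : 'M[C]_n).
  rewrite (_ : (fun k => _) = fun=> 1%:M); first exact: mcvg_cst.
  apply/funext => k; rewrite expsumS.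
  by rewrite big1 ?addr0 // => i _; rewrite exprS mul0r scaler0.
apply/esym; apply: mcvg_uniq h _; have := expsumP 0; rewrite /mcvg.
by rewrite -(@cvg_shiftS _ (fun k => nrm (expsum 0 k - expmx 0))).
Qed.

Lemma expsum_shift X N : mcvg (fun k => expsum X (k + N)) (expmx X).
Proof.
have := expsumP X; rewrite /mcvg.
by rewrite -(@cvg_shiftn N _ (fun k => nrm (expsum X k - expmx X))).
Qed.

(** As A and B are not assumed to commute, the difference of powers is telescoped one factor at a
    time. *)
Lemma nrm_subX A B (r : R) k : nrm A <= r -> nrm B <= r ->
  nrm (A ^+ k.+1 - B ^+ k.+1) <= k.+1%:R * r ^+ k * nrm (A - B).
Proof.
move=> Ar Br; have r0 : 0 <= r := le_trans (nrm_ge0 _) Ar.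
elim: k => [|k IH]; first by rewrite !expr1 expr0 !mul1r.
have -> : A ^+ k.+2 - B ^+ k.+2 =
    A *m (A ^+ k.+1 - B ^+ k.+1) + (A - B) *m B ^+ k.+1.
  by rewrite mulmxBr mulmxBl addrA subrK ![_ ^+ k.+2]exprS.
apply: le_trans (ler_nrmD _ _) _.
apply: (@le_trans _ _ (r * (k.+1%:R * r ^+ k * nrm (A - B)) +
   nrm (A - B) * r ^+ k.+1)); last first.
  by rewrite le_eqVlt [k.+2%:R]mulrS exprS; apply/orP; left; apply/eqP; ring.
apply: lerD; apply: le_trans (ler_nrmM _ _) _.
  by rewrite ler_pM ?nrm_ge0.
rewrite ler_wpM2l ?nrm_ge0 //; apply: le_trans (ler_nrmX _ _) _.
by rewrite lerXn2r ?nnegrE ?nrm_ge0.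
Qed.

(** In exp Z - Z only the constant and the terms of degree i + 2 remain; the latter are Lipschitz
    with constant r^(i+1) / (i+1)! on the ball of radius r, and these constants sum to at most e^r -
    1. Subtracting Z is what makes the constant small near 0. *)
Lemma expmx_lipschitz A B (r : R) : nrm A <= r -> nrm B <= r ->
  nrm ((expmx A - A) - (expmx B - B)) <= (expR r - 1) * nrm (A - B).
Proof.
move=> Ar Br; have r0 : 0 <= r := le_trans (nrm_ge0 _) Ar.
have h := mcvgD (expsum_shift A 2)
  (mcvgD (mcvg_affine (f := fun Y => - Y) (K := 1) _ (expsum_shift B 2))
    (mcvg_cst (B - A))).
have -> : (expmx A - A) - (expmx B - B) = expmx A + (- expmx B + (B - A)) - 0.
  rewrite subr0 opprB addrACA [- A + _]addrC -addrA; congr (_ + _).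
  by rewrite addrC -!addrA [- A + _]addrC addrA.
apply: mcvg_le; first apply: h.
  by move=> X Y; rewrite mul1r -opprD nrmN.
move=> k; rewrite subr0 addn2 !expsumSS.
rewrite (cancel_leading1 (1 : 'M[C]_n) A B) -sumrB.
apply: le_trans (ler_nrm_sum _ _ _) _.
apply: (@le_trans _ _ ((\sum_(0 <= i < k) r ^+ i.+1 / i.+1`!%:R) * nrm (A - B))).
  rewrite mulr_suml; apply: ler_sum => i _.
  rewrite -scalerBr nrmZ cabsV cabs_nat mulrC.
  rewrite ler_pdivrMr ?ltr0n ?fact_gt0 //.
  apply: le_trans (nrm_subX _ Ar Br) _.
  rewrite le_eqVlt; apply/orP; left; apply/eqP.
  rewrite [i.+2`!]factS natrM.
  have f0 : (i.+1`!%:R : R) != 0 by rewrite pnatr_eq0 -lt0n fact_gt0.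
  move: (i.+1`!%:R : R) (i.+2%:R : R) (r ^+ i.+1) (nrm _) f0 => F I X Y f0.
  by field.
by rewrite ler_wpM2r ?nrm_ge0 // sum_exp_coeffS_le.
Qed.

(** From e^(-r) >= 1 - r one gets e^r - 1 <= r e^r, and e^r <= 1 / (1 - r) <= 2. *)
Lemma expR_sub1_le (r : R) : 0 <= r <= 2^-1 -> expR r - 1 <= 2 * r.
Proof.
move=> /andP[r0 r1]; have h : 1 - r <= (expR r)^-1.
  by rewrite -expRN expR_ge1Dx.
have e0 := expR_gt0 r.
have : (1 - r) * expR r <= 1 by rewrite -ler_pdivlMr // div1r.
move: (expR r) e0 => e e0 h2.
nra.
Qed.

Lemma expmx_lipschitz2 A B (r : R) : r <= 2^-1 -> nrm A <= r -> nrm B <= r ->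
  nrm ((expmx A - A) - (expmx B - B)) <= 2 * r * nrm (A - B).
Proof.
move=> r1 Ar Br; apply: le_trans (expmx_lipschitz Ar Br) _.
rewrite ler_wpM2r ?nrm_ge0 // expR_sub1_le // r1 andbT.
exact: le_trans (nrm_ge0 _) Ar.
Qed.

Lemma expmx_sub1 A : nrm A <= 2^-1 -> nrm (expmx A - 1%:M) <= 2 * nrm A.
Proof.
(* Comparison with B = 0 at radius |A| gives |exp A - 1 - A| <= 2 |A|^2, which is at most |A|. *)
move=> A1; have := @expmx_lipschitz2 A 0 _ A1 (lexx _).
rewrite nrm0 nrm_ge0 expmx0 !subr0 => /(_ isT) h.
rewrite -(subrK A (expmx A - 1%:M)).
apply: le_trans (ler_nrmD _ _) _.
have -> : expmx A - 1%:M - A = expmx A - A - 1%:M by rewrite addrAC.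
have := nrm_ge0 A; move: (nrm A) (nrm _) h A1 => a b h A1 a0; nra.
Qed.

(* [exprZn] does not apply: square matrices of unknown size form no algebra. *)
Lemma exprZmx X (c : C) k : (c *: X) ^+ k = c ^+ k *: X ^+ k.
Proof.
elim: k => [|k IH]; first by rewrite !expr0 scale1r.
rewrite !exprS IH -!mulmxE -scalemxAl -scalemxAr scalerA.
by rewrite mulrC.
Qed.

Lemma expmx_comm X c : X *m expmx (c *: X) = expmx (c *: X) *m X.
Proof.
have hl := mcvg_affine (f := fun Y => X *m Y) (K := nrm X) _ (expsumP (c *: X)).
have hr := mcvg_affine (f := fun Y => Y *m X) (K := nrm X) _ (expsumP (c *: X)).
apply: (mcvg_uniq (u := fun k => X *m expsum (c *: X) k)).
  by apply: hl => A B; rewrite -mulmxBr ler_nrmM.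
rewrite (_ : (fun k => _) = fun k => expsum (c *: X) k *m X).
  by apply: hr => A B; rewrite -mulmxBl mulrC ler_nrmM.
apply/funext => k; rewrite expsumE mulmx_sumr mulmx_suml.
apply: eq_bigr => i _; rewrite -scalemxAr -scalemxAl exprZmx.
by rewrite -scalemxAr -scalemxAl -[X *m _]exprS exprSr.
Qed.

(** The constant is such that division by (k+2)! leaves r^k / k!, a term of the exponential
    series. *)
Lemma taylor2_pow (t h : C) (r : R) k : cabs t + cabs h <= r ->
  cabs ((t + h) ^+ k.+2 - t ^+ k.+2 - k.+2%:R * t ^+ k.+1 * h)
    <= k.+2%:R * k.+1%:R * r ^+ k * cabs h ^+ 2.
Proof.
move=> thr.
have thr' : cabs (t + h) <= r := le_trans (ler_cabsD _ _) thr.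
have r0 : 0 <= r := le_trans (cabs_ge0 _) thr'.
have tr : cabs t <= r by apply: le_trans thr; rewrite lerDl cabs_ge0.
elim: k => [|k IH].
  have -> : (t + h) ^+ 2 - t ^+ 2 - 2%:R * t ^+ 1 * h = h ^+ 2 by ring.
  by rewrite cabsX expr0 mulr1 mulr1 ler_peMl ?exprn_ge0 ?cabs_ge0 ?ler1n.
set d := (_ - _ - _) in IH.
have -> : (t + h) ^+ k.+3 - t ^+ k.+3 - k.+3%:R * t ^+ k.+2 * h =
    (t + h) * d + k.+2%:R * t ^+ k.+1 * h ^+ 2.
  by rewrite /d [k.+3%:R]mulrS !exprS; ring.
apply: le_trans (ler_cabsD _ _) _; rewrite !cabsM !cabsX cabs_nat.
apply: (@le_trans _ _ (r * (k.+2%:R * k.+1%:R * r ^+ k * cabs h ^+ 2) +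
   k.+2%:R * r ^+ k.+1 * cabs h ^+ 2)).
  apply: lerD; first by rewrite ler_pM ?cabs_ge0.
  rewrite -expr2; apply: ler_wpM2r; first by rewrite exprn_ge0 ?cabs_ge0.
  apply: ler_wpM2l => //.
  by apply: lerXn2r; rewrite ?nnegrE ?cabs_ge0.
rewrite -subr_ge0 [X in 0 <= X](_ : _ = k.+2%:R * (r ^+ k.+1 * cabs h ^+ 2)).
  by rewrite !mulr_ge0 ?exprn_ge0 ?cabs_ge0.
by rewrite [k.+3%:R]mulrS [k.+2%:R]mulrS !exprS; ring.
Qed.

(** The remainder is estimated on partial sums with a bound independent of their length, which
    therefore survives the limit; no series has to be differentiated. *)
Lemma expmx_taylor2 X (t h : C) : cabs h <= 1 ->
  nrm (expmx ((t + h) *: X) - expmx (t *: X) - h *: (X *m expmx (t *: X)))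
    <= nrm X ^+ 2 * expR ((cabs t + 1) * nrm X) * cabs h ^+ 2.
Proof.
move=> h1; set r := cabs t + 1.
have thr : cabs t + cabs h <= r by rewrite lerD2l.
have r0 : 0 <= r by rewrite addr_ge0 ?cabs_ge0.
(* The last sum is taken one term shorter because the factor X raises degrees by one; all three then
   stop at the same power of X. *)
have cv := mcvgD (expsum_shift ((t + h) *: X) 2)
  (mcvg_affine (f := fun Y => - Y) (K := 1) _
    (mcvgD (expsum_shift (t *: X) 2)
      (mcvg_affine (f := fun Y => h *: (X *m Y)) (K := cabs h * nrm X) _
         (expsum_shift (t *: X) 1)))).
have -> : expmx ((t + h) *: X) - expmx (t *: X) - h *: (X *m expmx (t *: X)) =
  expmx ((t + h) *: X) - (expmx (t *: X) + h *: (X *m expmx (t *: X))) - 0.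
  by rewrite subr0 opprD addrA.
apply: mcvg_le; first apply: cv.
- by move=> Y Z; rewrite mul1r -opprD nrmN.
- move=> Y Z; rewrite -scalerBr -mulmxBr nrmZ -mulrA.
  by rewrite ler_wpM2l ?cabs_ge0 // ler_nrmM.
move=> k; rewrite subr0 addn2 addn1.
have -> : expsum ((t + h) *: X) k.+2 -
  (expsum (t *: X) k.+2 + h *: (X *m expsum (t *: X) k.+1)) =
  \sum_(0 <= i < k) ((i.+2`!%:R : C)^-1 *
     ((t + h) ^+ i.+2 - t ^+ i.+2 - i.+2%:R * t ^+ i.+1 * h)) *: X ^+ i.+2.
  rewrite !expsumSS expsumS mulmxDr scalerDr [X *m 1]mulmx1 scalerDl.
  rewrite (cancel_leading2 (1 : 'M[C]_n) (t *: X) (h *: X)).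
  rewrite mulmx_sumr scaler_sumr -!sumrB.
  apply: eq_bigr => i _.
  rewrite -scalerDl !exprZmx -!scalemxAr -[X *m _]exprS.
  rewrite combine_scale; congr (_ *: X ^+ i.+2).
  rewrite [i.+2`!]factS natrM invfM.
  have f0 : (i.+1`!%:R : C) != 0 by rewrite pnatr_eq0 -lt0n fact_gt0.
  have i0 : (i.+2%:R : C) != 0 by rewrite pnatr_eq0.
  move: (i.+1`!%:R : C) (i.+2%:R : C) f0 i0 => F I f0 i0.
  by rewrite !exprS; field; rewrite f0 i0.
apply: le_trans (ler_nrm_sum _ _ _) _.
apply: (@le_trans _ _ (\sum_(0 <= i < k)
   nrm X ^+ 2 * ((r * nrm X) ^+ i / i`!%:R) * cabs h ^+ 2)).
  apply: ler_sum => i _; rewrite nrmZ !cabsM cabsV cabs_nat.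
  apply: (@le_trans _ _ (i.+2`!%:R^-1 * (i.+2%:R * i.+1%:R * r ^+ i * cabs h ^+ 2)
     * nrm X ^+ i.+2)).
    apply: ler_pM; rewrite ?nrm_ge0 ?mulr_ge0 ?invr_ge0 ?cabs_ge0 //.
      by rewrite ler_wpM2l ?invr_ge0 // taylor2_pow.
    exact: ler_nrmX.
  rewrite !factS !natrM !invfM exprMn.
  have f0 : (i`!%:R : R) != 0 by rewrite pnatr_eq0 -lt0n fact_gt0.
  have i0 : (i.+2%:R : R) != 0 by rewrite pnatr_eq0.
  have i1 : (i.+1%:R : R) != 0 by rewrite pnatr_eq0.
  rewrite le_eqVlt; apply/orP; left; apply/eqP.
  move: (i`!%:R : R) (i.+2%:R : R) (i.+1%:R : R) f0 i0 i1 => F I J f0 i0 i1.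
  by rewrite !exprS; field; rewrite f0 i0 i1.
rewrite -mulr_suml -mulr_sumr.
rewrite ler_wpM2r ?exprn_ge0 ?cabs_ge0 // ler_wpM2l ?exprn_ge0 ?nrm_ge0 //.
by apply: sum_exp_coeff_le; rewrite mulr_ge0 ?nrm_ge0.
Qed.

End Bounds.
End Exponential.

(** * Holomorphic curves and their derivatives *)

Section Derivatives.
Context {R : realType}.
Local Notation C := (Cplx R).

Lemma is_derive_of_quadratic (f : C -> C) (t df : C) (K : R) :
  (forall h, cabs h <= 1 -> cabs (f (t + h) - f t - h * df) <= K * cabs h ^+ 2) ->
  is_derive t (1 : C) f df.
Proof.
move=> fK; have K0 : 0 <= K.
  have := fK 1; rewrite cabs1 expr1n mulr1 lexx => /(_ isT); apply: le_trans.
  exact: cabs_ge0.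
have cv : (fun h : C => h^-1 *: (f (h *: (1 : C) + t) - f t)) @ 0^' --> df.
  apply/cvgrPdist_lt => e /pos_cplx[d d0 ->].
  pose r := Order.min 1 (d / (K + 1)).
  have r0 : 0 < r by rewrite lt_min ltr01 divr_gt0 // ltr_wpDl.
  exists ((r%:C)%C : C); first by rewrite /= ltcR.
  move=> h; rewrite /ball_ /= sub0r normrN normCE ltcR => hr h0.
  rewrite distrC normCE ltcR.
  have h1 : cabs h <= 1 by apply/ltW/(lt_le_trans hr); rewrite ge_min lexx.
  have hd : cabs h < d / (K + 1).
    by apply: (lt_le_trans hr); rewrite ge_min lexx orbT.
  have hpos : 0 < cabs h.
    rewrite lt_neqAle cabs_ge0 andbT eq_sym; apply/eqP => /cabs0_eq0 h00.
    by rewrite h00 eqxx in h0.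
  have -> : h^-1 *: (f (h *: (1 : C) + t) - f t) - df =
      h^-1 * (f (t + h) - f t - h * df).
    by rewrite -[h *: (1:C)]/(h * 1) mulr1 [h + t]addrC [RHS]mulrBr mulKf.
  rewrite cabsM cabsV mulrC ltr_pdivrMr //.
  apply: le_lt_trans (fK h h1) _.
  rewrite expr2 mulrA ltr_pM2r //.
  move: hd; rewrite ltr_pdivlMr; last by rewrite ltr_wpDl.
  by move: (cabs h) hpos => x x0; nra.
apply: DeriveDef; first by apply/cvg_ex; exists df.
exact: (cvg_lim (@norm_hausdorff C C)).
Qed.

Lemma is_derive_dist (f : C -> C) (t df : C) : is_derive t (1 : C) f df ->
  forall e : R, 0 < e -> exists2 d : R, 0 < d & forall h : C, h != 0 ->
    cabs h < d -> cabs (h^-1 * (f (h + t) - f t) - df) < e.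
Proof.
move=> [+ <-] e e0 => /cvgrPdist_lt /(_ ((e%:C)%C : C)).
rewrite ltcR => /(_ e0) [_ /= /pos_cplx[d d0 ->] hd].
exists d => // h h0 hd'.
have := hd h; rewrite /ball_ /= sub0r normrN normCE ltcR => /(_ hd' h0).
rewrite distrC normCE ltcR.
by rewrite -[h *: (1:C)]/(h * 1) mulr1.
Qed.

(** [p] stands for the real or the imaginary part. Restricting a holomorphic function to the real
    line in this way gives access to the mean value theorem. *)
Lemma is_derive_real (p : C -> R) (f : C -> C) (t : R) (df : C) :
  (forall z w, p (z - w) = p z - p w) ->
  (forall (x : R) z, p ((x%:C)%C * z) = x * p z) ->
  (forall z, `|p z| <= cabs z) ->
  is_derive ((t%:C)%C : C) (1 : C) f df ->
  is_derive t (1 : R) (fun s : R => p (f ((s%:C)%C : C))) (p df).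
Proof.
move=> pB pZ ple /is_derive_dist fd.
have cv : (fun h : R => h^-1 *: (p (f ((h *: (1 : R) + t)%:C)%C) -
    p (f (t%:C)%C))) @ 0^' --> p df.
  apply/cvgrPdist_lt => e e0; have [d d0 hd] := fd e e0.
  exists d => //= h; rewrite /ball_ /= sub0r normrN => hd' h0.
  rewrite distrC -[h *: 1]/(h * 1) mulr1.
  have hc0 : ((h%:C)%C : C) != 0.
    by apply: contra h0 => /eqP[->].
  have := hd ((h%:C)%C : C) hc0; rewrite cabs_real => /(_ hd').
  apply: le_lt_trans.
  rewrite -[h^-1 *: _]/(h^-1 * _) -pB -pZ -pB.
  apply: le_trans (ple _) _.
  rewrite -(rmorphV (real_complex R)); last by rewrite unitfE.
  by rewrite (rmorphD (real_complex R)) /=.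
apply: DeriveDef; first by apply/cvg_ex; exists (p df).
exact: (cvg_lim (@norm_hausdorff R R)).
Qed.

Lemma ReB (z w : C) : complex.Re (z - w) = complex.Re z - complex.Re w.
Proof. by case: z; case: w. Qed.
Lemma ImB (z w : C) : complex.Im (z - w) = complex.Im z - complex.Im w.
Proof. by case: z; case: w. Qed.
Lemma ReZ (x : R) (z : C) : complex.Re ((x%:C)%C * z) = x * complex.Re z.
Proof. by case: z => a b; simpc. Qed.
Lemma ImZ (x : R) (z : C) : complex.Im ((x%:C)%C * z) = x * complex.Im z.
Proof. by case: z => a b; simpc. Qed.

Definition is_derive_Re f t df :=
  @is_derive_real (@complex.Re R) f t df ReB ReZ (@Re_le_cabs R).
Definition is_derive_Im f t df :=
  @is_derive_real (@complex.Im R) f t df ImB ImZ (@Im_le_cabs R).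

Lemma derive0_cst (f : C -> C) : (forall t : C, is_derive t (1 : C) f 0) ->
  f 1 = f 0.
Proof.
move=> f0.
have hRe : complex.Re (f 1) = complex.Re (f 0).
  apply: (@is_derive_0_is_cst _ (fun s : R => complex.Re (f (s%:C)%C)) 1 0).
  by move=> x; exact: is_derive_Re (f0 _).
have hIm : complex.Im (f 1) = complex.Im (f 0).
  apply: (@is_derive_0_is_cst _ (fun s : R => complex.Im (f (s%:C)%C)) 1 0).
  by move=> x; exact: is_derive_Im (f0 _).
by move: hRe hIm; case: (f 1) => a b; case: (f 0) => c d /= -> ->.
Qed.

(* Taylor's formula at 0 for a function all of whose derivatives vanish there
   and grow at most geometrically. *)
Lemma flat_real (f : nat -> R -> R) (A r : R) :
  (forall k t, is_derive t (1 : R) (f k) (f k.+1 t)) ->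
  (forall k, f k 0 = 0) ->
  (forall k t, 0 <= t <= 1 -> `|f k t| <= A * r ^+ k) ->
  f 0%N 1 = 0.
Proof.
move=> fd f0 fA.
(* All orders [k] are treated at once: the bound for f^(k+1) with N integrates to the bound for
   f^(k) with N + 1. *)
have bound N : forall k t, 0 <= t <= 1 ->
    `|f k t| <= A * r ^+ (k + N) * (t ^+ N / N`!%:R).
  elim: N => [|N IH] k t t01.
    by rewrite addn0 expr0 fact0 divr1 mulr1 fA.
  (* The primitive, vanishing at 0, of the bound given by the induction hypothesis; both g - f^(k)
     and g + f^(k) are nondecreasing on [0, 1]. *)
  pose g (s : R) := A * r ^+ (k.+1 + N) * (N.+1`!%:R)^-1 * s ^+ N.+1.
  have gd s : is_derive s (1 : R) g (A * r ^+ (k.+1 + N) * (s ^+ N / N`!%:R)).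
    have -> : g = (A * r ^+ (k.+1 + N) * (N.+1`!%:R)^-1) *: (id ^+ N.+1).
      by apply/funext => u; rewrite /g -[RHS]/(_ * _) fctE.
    have hd := is_deriveZ (A * r ^+ (k.+1 + N) * (N.+1`!%:R)^-1)
      (is_deriveX N.+1 (is_derive_id (s : R) (1 : R))).
    apply: is_derive_eq hd _.
    rewrite -[_ *: (_ *: _)]/(_ * (_ * _)) mulr1 factS natrM invfM /=.
    have n0 : (N.+1%:R : R) != 0 by rewrite pnatr_eq0.
    have F0 : (N`!%:R : R) != 0 by rewrite pnatr_eq0 -lt0n fact_gt0.
    by move: (N.+1%:R : R) (N`!%:R : R) n0 F0 => a b a0 b0; field; rewrite a0 b0.
  have mono (h dh : R -> R) : (forall s, is_derive s (1 : R) h (dh s)) ->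
      h 0 = 0 -> (forall s, 0 <= s <= 1 -> 0 <= dh s) -> 0 <= h t.
    move=> hd h0 dh0; rewrite -h0.
    have [t0 t1] := andP t01.
    move: t0; rewrite le_eqVlt => /orP[/eqP <- //|t0].
    have dI (s : R) : s \in `]0, t[ -> is_derive s (1 : R) h (dh s) by [].
    have cI : {within `[0, t], continuous h}.
      by apply: derivable_within_continuous => s _; have [] := hd s.
    have [c + hE] := MVT t0 dI cI.
    rewrite in_itv /= => /andP[c0 ct].
    rewrite -subr_ge0 hE mulr_ge0 ?subr0 ?(ltW t0) //.
    by apply: dh0; rewrite (ltW c0) (le_trans (ltW ct) t1).
  have g0 : g 0 = 0 by rewrite /g expr0n /= mulr0.
  have gt : g t = A * r ^+ (k + N.+1) * (t ^+ N.+1 / N.+1`!%:R).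
    by rewrite /g addSnnS mulrAC mulrA.
  rewrite -gt ler_norml; apply/andP; split.
    rewrite -subr_ge0 opprK.
    apply: (mono _ _ (fun s => is_deriveD (fd k s) (gd s))).
      by rewrite fctE f0 g0 addr0.
    move=> s s01; have := IH k.+1 s s01; rewrite ler_norml => /andP[+ _].
    by rewrite -subr_ge0 opprK.
  rewrite -subr_ge0.
  apply: (mono _ _ (fun s => is_deriveB (gd s) (fd k s))).
    by rewrite -[LHS]/(g 0 - f k 0) f0 g0 subr0.
  move=> s s01; have := IH k.+1 s s01; rewrite ler_norml => /andP[_].
  by rewrite -subr_ge0.
(* For k = 0 and t = 1 the bound is A r^N / N!, which tends to 0 as a term of a convergent
   series. *)
have lim0 : (fun k => A * exp_coeff r k) @ \oo --> A * (0 : R).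
  apply: cvgMl_tmp; apply: (@cvg_series_cvg_0 R R^o).
  exact: is_cvg_series_exp_coeff.
apply/eqP; rewrite -normr_le0; apply/ler_addgt0Pr => e e0; rewrite add0r.
move/cvgrPdist_lt : lim0 => /(_ e e0)[N _ /(_ N (leqnn _))] /=.
rewrite mulr0 sub0r normrN => h.
have := bound N 0%N 1; rewrite ler01 lexx => /(_ isT) h2.
apply: le_trans h2 _; apply: le_trans (ltW h).
rewrite add0n expr1n mul1r -mulrA.
exact: ler_norm.
Qed.

Lemma flat_complex (f : nat -> C -> C) (A r : R) :
  (forall k t, is_derive t (1 : C) (f k) (f k.+1 t)) ->
  (forall k, f k 0 = 0) ->
  (forall k (t : R), 0 <= t <= 1 -> cabs (f k (t%:C)%C) <= A * r ^+ k) ->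
  f 0%N 1 = 0.
Proof.
move=> fd f0 fA.
have hRe : complex.Re (f 0%N 1) = 0.
  apply: (@flat_real (fun k s => complex.Re (f k (s%:C)%C)) A r).
  - by move=> k t; exact: is_derive_Re (fd k _).
  - by move=> k; rewrite [f k _]f0.
  - by move=> k t t01; apply: le_trans (Re_le_cabs _) (fA k t t01).
have hIm : complex.Im (f 0%N 1) = 0.
  apply: (@flat_real (fun k s => complex.Im (f k (s%:C)%C)) A r).
  - by move=> k t; exact: is_derive_Im (fd k _).
  - by move=> k; rewrite [f k _]f0.
  - by move=> k t t01; apply: le_trans (Im_le_cabs _) (fA k t t01).
by move: hRe hIm; case: (f 0%N 1) => a b /= -> ->.
Qed.

Lemma is_derive_bigsum (I : finType) (f : I -> C -> C) (t : C) (df : I -> C) :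
  (forall i, is_derive t (1 : C) (f i) (df i)) ->
  is_derive t (1 : C) (fun s => \sum_i f i s) (\sum_i df i).
Proof.
move=> fd; rewrite (_ : (fun s => _) = \sum_i f i); last first.
  by apply/funext => s; rewrite fct_sumE.
elim/big_ind2 : _ => [|f1 a1 f2 a2 h1 h2|i _]; first exact: is_derive_cst.
  exact: is_deriveD.
exact: fd.
Qed.

Lemma is_deriveMc (f g : C -> C) (t df dg : C) :
  is_derive t (1 : C) f df -> is_derive t (1 : C) g dg ->
  is_derive t (1 : C) (fun s => f s * g s) (df * g t + f t * dg).
Proof.
move=> fd gd; have h := is_deriveM fd gd.
apply: is_derive_eq h _.
by rewrite addrC [g t *: df]mulrC.
Qed.

Lemma is_deriveDc (f g : C -> C) (t df dg : C) :
  is_derive t (1 : C) f df -> is_derive t (1 : C) g dg ->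
  is_derive t (1 : C) (fun s => f s + g s) (df + dg).
Proof. by move=> fd gd; exact: (is_deriveD fd gd). Qed.

Lemma is_deriveCM (c : C) (f : C -> C) (t df : C) :
  is_derive t (1 : C) f df -> is_derive t (1 : C) (fun s => c * f s) (c * df).
Proof. by move=> fd; exact: (is_deriveZ c fd). Qed.

Lemma is_derive_expmx n (X : 'M[C]_n) i j (t : C) :
  is_derive t (1 : C) (fun s => expmx (s *: X) i j) ((X *m expmx (t *: X)) i j).
Proof.
apply: is_derive_of_quadratic => h h1; apply: le_trans (expmx_taylor2 X t h1).
by apply: le_trans (cabs_le_nrm _ i j); rewrite !mxE.
Qed.

Lemma is_derive_expmxN n (X : 'M[C]_n) i j (t : C) :
  is_derive t (1 : C) (fun s => expmx (- s *: X) i j)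
    (- (X *m expmx (- t *: X)) i j).
Proof.
have -> : (fun s : C => expmx (- s *: X) i j) = (fun s => expmx (s *: - X) i j).
  by apply/funext => s; rewrite scaleNr scalerN.
apply: is_derive_eq (is_derive_expmx (- X) i j t) _.
by rewrite scalerN -scaleNr mulNmx mxE.
Qed.

Lemma is_derive_mulmx m n p (A : C -> 'M[C]_(m, n)) (B : C -> 'M[C]_(n, p))
    (dA : 'M[C]_(m, n)) (dB : 'M[C]_(n, p)) (t : C) :
  (forall i j, is_derive t (1 : C) (fun s => A s i j) (dA i j)) ->
  (forall i j, is_derive t (1 : C) (fun s => B s i j) (dB i j)) ->
  forall i j, is_derive t (1 : C) (fun s => (A s *m B s) i j)
    ((dA *m B t + A t *m dB) i j).
Proof.
move=> Ad Bd i j.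
have -> : (fun s : C => (A s *m B s) i j) = fun s => \sum_k A s i k * B s k j.
  by apply/funext => s; rewrite mxE.
have -> : (dA *m B t + A t *m dB) i j =
    \sum_k (dA i k * B t k j + A t i k * dB k j).
  by rewrite !mxE -big_split.
by apply: is_derive_bigsum => k; apply: is_deriveMc.
Qed.

(** Multiplying two series is avoided: exp (sX) exp (-sX) has zero derivative because X commutes
    with its exponentials. *)
Lemma expmxNK n (X : 'M[C]_n) : expmx X *m expmx (- X) = 1%:M.
Proof.
pose F (s : C) : 'M[C]_n := expmx (s *: X) *m expmx (- s *: X).
have F1 : F 1 = F 0.
  apply/matrixP => i j; apply: (@derive0_cst (fun s => F s i j)) => t.
  have dN k l : is_derive t (1 : C) (fun s => expmx (- s *: X) k l)
      ((- (X *m expmx (- t *: X))) k l).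
    by rewrite mxE; exact: is_derive_expmxN.
  have h := is_derive_mulmx (fun i j => is_derive_expmx X i j t) dN i j.
  apply: is_derive_eq h _.
  by rewrite mulmxN mulmxA expmx_comm -!mulmxA subrr mxE.
move: F1; rewrite /F scale1r scaleN1r oppr0 !scale0r expmx0 mulmx1.
exact.
Qed.

Lemma expmx_unit n (X : 'M[C]_n) : expmx X \in unitmx.
Proof. exact: (mulmx1_unit (expmxNK X)).1. Qed.

Lemma invmx_expmx n (X : 'M[C]_n) : invmx (expmx X) = expmx (- X).
Proof.
by rewrite -[RHS]mul1mx -(mulVmx (expmx_unit X)) -mulmxA expmxNK mulmx1.
Qed.

End Derivatives.

(** * Polynomials and derivations *)

Lemma taylor_sum_id (K : comNzRingType) (p q p0 q0 dp dq : K) :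
  p + q - (p0 + q0) - (dp + dq) = (p - p0 - dp) + (q - q0 - dq).
Proof. by ring. Qed.

Lemma taylor_prod_id (K : comNzRingType) (p q p0 q0 dp dq : K) :
  p * q - p0 * q0 - (dp * q0 + p0 * dq) =
    p0 * (q - q0 - dq) + q0 * (p - p0 - dp) + (p - p0) * (q - q0).
Proof. by ring. Qed.

Lemma leibniz_sum_id (K : comNzRingType) (a b c d e : K) :
  (a * b + c * d) * e = a * e * b + c * (d * e).
Proof. by ring. Qed.

Section Polynomials.
Context {R : realType}.
Local Notation C := (Cplx R).
Local Notation var i := (mpolyX C (mnm1 i)).

Lemma mderiv_var N (i k : 'I_N) : mderiv k (var i) = (i == k)%:R.
Proof.
rewrite mderivX mnm1E; case: eqP => [<-|_]; last by rewrite scale0r.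
rewrite scale1r -(mpolyX0 N C); congr (mpolyX _ _).
by apply/mnmP => j; rewrite mnmBE mnm0E subnn.
Qed.

(** Reduces a property of polynomials to the generators of the algebra, so that Taylor and chain
    rule statements need only be checked for sums and products. *)
Lemma mpoly_alg_ind N (P : mpoly N C -> Prop) :
  (forall c, P (mpolyC N c)) -> (forall i, P (var i)) ->
  (forall p q, P p -> P q -> P (p + q)) ->
  (forall p q, P p -> P q -> P (p * q)) -> forall p, P p.
Proof.
move=> PC PX PD PM; apply: mpolyind => [|c m p _ _ Pp].
  by rewrite -(mpolyC0 N C).
apply: (PD) => //; rewrite -mul_mpolyC; apply: (PM) => //.
rewrite mpolyXE_id; apply: big_ind => [|p1 p2|i _]; [by rewrite -(mpolyC1 N C)|exact: PM|].
elim: (m i) => [|k IH]; first by rewrite expr0 -(mpolyC1 N C).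
by rewrite exprS; exact: PM.
Qed.

(** The formal differential dp_a(v). At the identity matrix, its vanishing for all p in the ideal
    is, by conversion, the definition of [lie_algebra]. *)
Definition dder N (p : mpoly N C) (a v : 'I_N -> C) : C :=
  \sum_k meval a (mderiv k p) * v k.

Section Dder.
Context {N : nat}.
Implicit Types (p q : mpoly N C) (a v : 'I_N -> C).

Lemma dderC c a v : dder (mpolyC N c) a v = 0.
Proof. by apply: big1 => k _; rewrite mderivC meval0 mul0r. Qed.

Lemma dderX i a v : dder (var i) a v = v i.
Proof.
rewrite /dder (bigD1 i) //= big1 => [|k ki].
  by rewrite mderiv_var eqxx meval1 mul1r addr0.
by rewrite mderiv_var eq_sym (negbTE ki) meval0 mul0r.
Qed.

Lemma dderD p q a v : dder (p + q) a v = dder p a v + dder q a v.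
Proof.
rewrite /dder -big_split /=; apply: eq_bigr => k _.
by rewrite mderivD mevalD mulrDl.
Qed.

Lemma dderM p q a v :
  dder (p * q) a v = dder p a v * meval a q + meval a p * dder q a v.
Proof.
rewrite /dder mulr_suml mulr_sumr -big_split /=; apply: eq_bigr => k _.
rewrite mderivM mevalD !mevalM mulrDl mulrA; congr (_ + _).
exact: mulrAC.
Qed.

Lemma dder_eq p a a' v v' : a =1 a' -> v =1 v' -> dder p a v = dder p a' v'.
Proof.
move=> aa vv; apply: eq_bigr => k _; rewrite vv.
by rewrite (meval_eq _ aa).
Qed.

Lemma is_derive_meval p (a : C -> 'I_N -> C) (da : 'I_N -> C) (t : C) :
  (forall i, is_derive t (1 : C) (fun s => a s i) (da i)) ->
  is_derive t (1 : C) (fun s => meval (a s) p) (dder p (a t) da).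
Proof.
move=> ad; elim/mpoly_alg_ind: p => [c|i|p q pd qd|p q pd qd].
- rewrite dderC (_ : (fun s => _) = cst c); first exact: is_derive_cst.
  by apply/funext => s; rewrite mevalC.
- rewrite dderX (_ : (fun s => _) = fun s => a s i) //.
  by apply/funext => s; rewrite mevalXU.
- rewrite dderD (_ : (fun s => _) =
      fun s => meval (a s) p + meval (a s) q).
    exact: (is_deriveDc pd qd).
  by apply/funext => s; rewrite mevalD.
- rewrite dderM (_ : (fun s => _) = fun s => meval (a s) p * meval (a s) q).
    exact: (is_deriveMc pd qd).
  by apply/funext => s; rewrite mevalM.
Qed.

Definition vnrm v : R := \sum_i cabs (v i).

Lemma vnrm_ge0 v : 0 <= vnrm v.
Proof. by apply: sumr_ge0 => i _; exact: cabs_ge0. Qed.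

Lemma cabs_le_vnrm v i : cabs (v i) <= vnrm v.
Proof.
by rewrite /vnrm (bigD1 i) //= lerDl; apply: sumr_ge0 => k _; exact: cabs_ge0.
Qed.

Lemma dder_le p a : exists2 K : R, 0 <= K &
  forall v, cabs (dder p a v) <= K * vnrm v.
Proof.
exists (\sum_k cabs (meval a (mderiv k p))).
  by apply: sumr_ge0 => k _; exact: cabs_ge0.
move=> v; apply: le_trans (ler_cabs_sum _ _ _) _; rewrite mulr_suml.
by apply: ler_sum => k _; rewrite cabsM ler_wpM2l ?cabs_ge0 ?cabs_le_vnrm.
Qed.

(** The remainder of a product combines the two remainders with a product of two first-order
    increments, all of second order. The restriction to the unit ball lets a linear bound absorb the
    quadratic part of an increment. *)
Lemma meval_taylor2 p a : exists2 K : R, 0 <= K & forall v, vnrm v <= 1 ->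
  cabs (meval (fun i => a i + v i) p - meval a p - dder p a v)
    <= K * vnrm v ^+ 2.
Proof.
elim/mpoly_alg_ind: p => [c|i|p q [K K0 pK] [L L0 qL]|p q [K K0 pK] [L L0 qL]].
- exists 0 => // v _; rewrite !mevalC dderC subrr subr0 cabs0 mul0r.
  exact: lexx.
- by exists 0 => // v _; rewrite !mevalXU dderX [a i + _]addrC addrK subrr cabs0 mul0r.
- exists (K + L); rewrite ?addr_ge0 // => v v1.
  rewrite !mevalD dderD mulrDl.
  rewrite taylor_sum_id; apply: le_trans (lerD (pK v v1) (qL v v1)).
  exact: ler_cabsD.
have [D D0 pD] := dder_le p a; have [E E0 qE] := dder_le q a.
exists (cabs (meval a p) * L + cabs (meval a q) * K + (D + K) * (E + L)).
  by rewrite !addr_ge0 ?mulr_ge0 ?cabs_ge0 ?addr_ge0.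
move=> v v1; rewrite !mevalM dderM.
move: (pK v v1) (qL v v1) (pD v) (qE v).
set p' := meval _ p; set q' := meval _ q; set dp := dder p a v.
set dq := dder q a v; set p0 := meval a p; set q0 := meval a q => hp hq hdp hdq.
rewrite taylor_prod_id.
have sq (x : R) (D' K' : R) : 0 <= D' -> 0 <= K' -> 0 <= x -> x <= 1 ->
    D' * x + K' * x ^+ 2 <= (D' + K') * x.
  move=> D'0 K'0 x0 x1; rewrite mulrDl lerD2l expr2 ler_wpM2l //.
  by rewrite ler_piMr.
have n0 := vnrm_ge0 v.
have hp' : cabs (p' - p0) <= (D + K) * vnrm v.
  rewrite -(subrK dp (p' - p0)) addrC; apply: le_trans (ler_cabsD _ _) _.
  by apply: le_trans (sq _ _ _ D0 K0 n0 v1); exact: lerD.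
have hq' : cabs (q' - q0) <= (E + L) * vnrm v.
  rewrite -(subrK dq (q' - q0)) addrC; apply: le_trans (ler_cabsD _ _) _.
  by apply: le_trans (sq _ _ _ E0 L0 n0 v1); exact: lerD.
apply: le_trans (ler_cabsD _ _) _.
apply: (@le_trans _ _ (cabs p0 * (L * vnrm v ^+ 2) +
    cabs q0 * (K * vnrm v ^+ 2) + (D + K) * vnrm v * ((E + L) * vnrm v))).
  apply: lerD; last by rewrite cabsM ler_pM ?cabs_ge0.
  apply: le_trans (ler_cabsD _ _) _.
  by apply: lerD; rewrite cabsM ler_wpM2l ?cabs_ge0.
by rewrite le_eqVlt; apply/orP; left; apply/eqP; ring.
Qed.

End Dder.

Lemma dder_comp M N (p : mpoly N C) (lq : N.-tuple (mpoly M C)) (a v : 'I_M -> C) :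
  dder (comp_mpoly lq p) a v =
  dder p (fun i => meval a (tnth lq i)) (fun i => dder (tnth lq i) a v).
Proof.
elim/mpoly_alg_ind: p => [c|i|p q pd qd|p q pd qd].
- by rewrite comp_mpolyC !dderC.
- by rewrite dderX /comp_mpoly mmapX mmap1U.
- rewrite comp_mpolyD [LHS]dderD [RHS]dderD.
  by congr (_ + _); [exact: pd|exact: qd].
- rewrite (rmorphM (comp_mpoly lq)) [LHS]dderM [RHS]dderM.
  congr (_ * _ + _ * _); [exact: pd|exact: comp_mpoly_meval| |exact: qd].
  exact: comp_mpoly_meval.
Qed.

(** Composition with this tuple is the pullback of polynomials along the linear map v -> vA on row
    vectors. *)
Definition linsub M N (A : 'M[C]_(M, N)) : N.-tuple (mpoly M C) :=
  [tuple \sum_l A l k *: var l | k < N].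

Lemma meval_linsub M N (A : 'M[C]_(M, N)) (a : 'I_M -> C) k :
  meval a (tnth (linsub A) k) = \sum_l A l k * a l.
Proof.
rewrite tnth_mktuple raddf_sum /=; apply: eq_bigr => l _.
by rewrite mevalZ mevalXU.
Qed.

Lemma dder_linsub M N (A : 'M[C]_(M, N)) (a v : 'I_M -> C) k :
  dder (tnth (linsub A) k) a v = \sum_l A l k * v l.
Proof.
rewrite tnth_mktuple.
have h : {morph (fun p : mpoly M C => dder p a v) : p q / p + q >-> p + q}.
  by move=> p q; exact: dderD.
rewrite (big_morph _ h (_ : dder 0 a v = 0)); last first.
  by rewrite -(mpolyC0 M C) dderC.
apply: eq_bigr => l _; rewrite -mul_mpolyC dderM dderC mul0r add0r mevalC.
by rewrite dderX.
Qed.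

(* The derivation along the linear vector field v |-> v A (row convention). *)
Definition lder N (A : 'M[C]_N) (p : mpoly N C) : mpoly N C :=
  \sum_k mderiv k p * tnth (linsub A) k.

Lemma meval_lder N (A : 'M[C]_N) p a :
  meval a (lder A p) = dder p a (fun k => \sum_l A l k * a l).
Proof.
rewrite /lder raddf_sum /=; apply: eq_bigr => k _.
by rewrite mevalM meval_linsub.
Qed.

Lemma lderD N (A : 'M[C]_N) : {morph lder A : p q / p + q}.
Proof.
move=> p q; rewrite /lder -big_split /=; apply: eq_bigr => k _.
by rewrite mderivD mulrDl.
Qed.

Lemma lderM N (A : 'M[C]_N) p q : lder A (p * q) = lder A p * q + p * lder A q.
Proof.
rewrite /lder mulr_suml mulr_sumr -big_split /=; apply: eq_bigr => k _.
by rewrite mderivM leibniz_sum_id.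
Qed.

Lemma lderC N (A : 'M[C]_N) c : lder A (mpolyC N c) = 0.
Proof. by apply: big1 => k _; rewrite mderivC mul0r. Qed.

Lemma lderX N (A : 'M[C]_N) i : lder A (var i) = tnth (linsub A) i.
Proof.
rewrite /lder (bigD1 i) //= big1 => [|k ki].
  by rewrite mderiv_var eqxx mul1r addr0.
by rewrite mderiv_var eq_sym (negbTE ki) mul0r.
Qed.

Lemma lderZ N (A : 'M[C]_N) c p : lder A (c *: p) = c *: lder A p.
Proof. by rewrite -mul_mpolyC lderM lderC mul0r add0r mul_mpolyC. Qed.

Lemma lder0 N (A : 'M[C]_N) : lder A 0 = 0.
Proof. by rewrite -(mpolyC0 N C) lderC mpolyC0. Qed.

Lemma iter_lderD N (A : 'M[C]_N) k : {morph iter k (lder A) : p q / p + q}.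
Proof. by elim: k => [//|k IH] p q; rewrite !iterS IH lderD. Qed.

Lemma iter_lderZ N (A : 'M[C]_N) k c p :
  iter k (lder A) (c *: p) = c *: iter k (lder A) p.
Proof. by elim: k => [//|k IH]; rewrite !iterS IH lderZ. Qed.

Lemma iter_lder0 N (A : 'M[C]_N) k : iter k (lder A) 0 = 0.
Proof. by elim: k => [//|k IH]; rewrite iterS IH lder0. Qed.

(* A derivation grows at most geometrically, because linear forms stay linear
   forms under a linear vector field. *)
Lemma iter_lder_le N (A : 'M[C]_N) (B : R) p : 0 <= B ->
  exists K r : R, [/\ 0 <= K, 0 <= r & forall k a,
    (forall i, cabs (a i) <= B) -> cabs (meval a (iter k (lder A) p)) <= K * r ^+ k].
Proof.
move=> B0.
elim/mpoly_alg_ind: p => [c|i|p q [K [r [K0 r0 h]]] [L [s [L0 s0 h']]]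
   |p q [K [r [K0 r0 h]]] [L [s [L0 s0 h']]]].
- exists (cabs c), 0; split; rewrite ?cabs_ge0 // => -[|k] a aB.
    by rewrite /= mevalC expr0 mulr1.
  by rewrite iterSr lderC iter_lder0 meval0 cabs0 exprS mul0r mulr0.
- exists B, (nrm A); split; rewrite ?nrm_ge0 // => k a aB.
  elim: k i => [|k IH] i; first by rewrite /= mevalXU expr0 mulr1.
  rewrite iterSr lderX tnth_mktuple.
  rewrite (big_morph _ (iter_lderD A k) (iter_lder0 A k)) raddf_sum /=.
  apply: le_trans (ler_cabs_sum _ _ _) _.
  apply: (@le_trans _ _ (\sum_l cabs (A l i) * (B * nrm A ^+ k))).
    apply: ler_sum => l _; rewrite iter_lderZ mevalZ cabsM.
    by rewrite ler_wpM2l ?cabs_ge0.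
  rewrite -mulr_suml exprS [leRHS]mulrCA ler_wpM2r //.
    by rewrite mulr_ge0 ?exprn_ge0 ?nrm_ge0.
  apply: ler_sum => l _; rewrite (bigD1 i) //= lerDl.
  by apply: sumr_ge0 => j _; exact: cabs_ge0.
- exists (K + L), (r + s); split; rewrite ?addr_ge0 // => k a aB.
  rewrite iter_lderD mevalD mulrDl; apply: le_trans (ler_cabsD _ _) _.
  apply: lerD.
    apply: le_trans (h k a aB) _; rewrite ler_wpM2l //.
    by rewrite lerXn2r ?nnegrE ?addr_ge0 // lerDl.
  apply: le_trans (h' k a aB) _; rewrite ler_wpM2l //.
  by rewrite lerXn2r ?nnegrE ?addr_ge0 // lerDr.
exists (K * L), (r + s); split; rewrite ?mulr_ge0 ?addr_ge0 // => k a aB.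
have {}h j := h j a aB; have {}h' j := h' j a aB.
(* The induction is over all p and q: by Leibniz, D^(k+1)(pq) = D^k(Dp q) + D^k(p Dq), where passing
   from p to Dp multiplies K by r and passing from q to Dq multiplies L by s. Hence the rate r +
   s. *)
elim: k p q K L K0 L0 h h' => [|k IH] p q K L K0 L0 h h'.
  by rewrite /= mevalM cabsM expr0 mulr1 ler_pM ?cabs_ge0 //;
    [have := h 0%N | have := h' 0%N]; rewrite expr0 mulr1.
rewrite iterSr lderM iter_lderD mevalD exprS.
apply: le_trans (ler_cabsD _ _) _.
have -> : K * L * ((r + s) * (r + s) ^+ k) =
  K * r * L * (r + s) ^+ k + K * (L * s) * (r + s) ^+ k by ring.
apply: lerD; apply: IH; rewrite ?mulr_ge0 //.
  by move=> j; have := h j.+1; rewrite iterSr exprS mulrA.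
by move=> j; have := h' j.+1; rewrite iterSr exprS mulrA.
Qed.

End Polynomials.

(** * Algebraic groups and their Lie algebras *)

Lemma geo_le (R : realFieldType) (e x : R) : 0 <= e -> 0 <= x ->
  2 * e * (1 - x) <= 2 * e.
Proof. by move=> e0 x0; rewrite ler_piMr ?mulr_ge0 // lerBlDr lerDl. Qed.

Lemma geo_step (R : realFieldType) (e x : R) :
  e * x + 2 * e * (1 - x) = 2 * e * (1 - 2^-1 * x).
Proof. by field. Qed.

Lemma subrBB (V : zmodType) (a b c : V) : (a - b) - (a - c) = c - b.
Proof. by rewrite opprB addrC addrA subrK. Qed.

Lemma fixpoint_eq (V : zmodType) (g e x : V) : x = g - (e - x) -> e = g.
Proof.
move=> h; have : x + e = g + x by rewrite {1}h opprB addrA subrK.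
by rewrite addrC => /addIr.
Qed.

Section Logarithm.
Context {R : realType} {n : nat}.
Local Notation C := (Cplx R).
Implicit Types X Y Z : 'M[C]_n.

Lemma nrm_expmx_le X : nrm (expmx X) <= n.+1%:R * expR (nrm X).
Proof.
rewrite -[expmx X]subr0; apply: (mcvg_le (expsumP X)) => k; rewrite subr0 expsumE.
apply: le_trans (ler_nrm_sum _ _ _) _.
apply: (@le_trans _ _ (\sum_(0 <= i < k) n.+1%:R * (nrm X ^+ i / i`!%:R))).
  apply: ler_sum => i _; rewrite nrmZ cabsV cabs_nat mulrC mulrA.
  by rewrite ler_wpM2r ?invr_ge0 // nrmX_le.
by rewrite -mulr_sumr ler_wpM2l // sum_exp_coeff_le ?nrm_ge0.
Qed.

(* The logarithm of g is the fixed point of Z |-> g - (exp Z - Z), a contraction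
   near 0. *)
Lemma expmx_surj (g : 'M[C]_n) (e : R) : e <= 8^-1 -> nrm (g - 1%:M) <= e ->
  exists2 X, nrm X <= 2 * e & expmx X = g.
Proof.
move=> e8 ge; have e0 : 0 <= e := le_trans (nrm_ge0 _) ge.
pose phi Z := expmx Z - Z.
(* On the ball of radius [2 * e] the Lipschitz constant is [4 * e], at most 1/2 because
   [e <= 8^-1]. *)
have phiL Y Z : nrm Y <= 2 * e -> nrm Z <= 2 * e ->
    nrm (phi Y - phi Z) <= 2^-1 * nrm (Y - Z).
  move=> Ye Ze; apply: le_trans (expmx_lipschitz2 _ Ye Ze) _.
    by lra.
  by apply: ler_wpM2r; rewrite ?nrm_ge0 //; lra.
pose Z k := iter k (fun Y => g - phi Y) 0.
have ZS k : Z k.+1 = g - phi (Z k) by [].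
(* The second bound is the sum of the first over the earlier steps; it keeps the iterates in the
   ball where [phi] contracts. *)
have Zb k : nrm (Z k.+1 - Z k) <= e * 2^-1 ^+ k /\
    nrm (Z k) <= 2 * e * (1 - 2^-1 ^+ k).
  elim: k => [|k [IH1 IH2]].
    rewrite /Z /= /phi expmx0 subr0 subr0 nrm0 expr0 mulr1 subrr mulr0.
    by split.
  have h0 j : 0 <= 2^-1 ^+ j :> R by rewrite exprn_ge0.
  have hk : nrm (Z k) <= 2 * e by apply: le_trans IH2 _; exact: geo_le.
  have hS : nrm (Z k.+1) <= 2 * e * (1 - 2^-1 ^+ k.+1).
    rewrite -(subrK (Z k) (Z k.+1)); apply: le_trans (ler_nrmD _ _) _.
    by apply: le_trans (lerD IH1 IH2) _; rewrite exprS geo_step.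
  split => //.
  have hS' : nrm (Z k.+1) <= 2 * e.
    by apply: le_trans hS _; exact: geo_le.
  have -> : Z k.+2 - Z k.+1 = phi (Z k) - phi (Z k.+1).
    by rewrite (ZS k.+1) {2}(ZS k) subrBB.
  apply: le_trans (phiL _ _ hk hS') _; rewrite nrm_sym.
  by rewrite exprS mulrCA ler_wpM2l // invr_ge0.
have Zle k : nrm (Z k) <= 2 * e.
  have [_ h] := Zb k; apply: le_trans h _.
  by apply: geo_le => //; exact: exprn_ge0.
have [||X ZX] := @mcvg_exists R n n Z (geometric e 2^-1).
- by move=> k; have [] := Zb k.
- by apply: is_cvg_geometric_series; rewrite ger0_norm //; lra.
have Xe : nrm X <= 2 * e.
  by rewrite -[X]subr0; apply: (mcvg_le ZX) => k; rewrite subr0.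
exists X => //.
have h1 : mcvg (fun k => Z k.+1) X.
  by move: ZX; rewrite /mcvg -(@cvg_shiftS _ (fun k => nrm (Z k - X))).
have h2 : mcvg (fun k => Z k.+1) (g - phi X).
  apply: (@mcvg_bounded _ _ _ _ _ (fun k => 2^-1 * nrm (Z k - X))).
    move=> k; rewrite ZS.
    by rewrite subrBB nrm_sym; exact: phiL.
  by rewrite -(mulr0 2^-1); apply: cvgMl_tmp; exact: ZX.
exact: fixpoint_eq (mcvg_uniq h1 h2).
Qed.

End Logarithm.

(** * Finite subsystems of a linear system *)

Section FiniteCut.
Context {K : fieldType} {T : eqType} {N : nat} (F : T -> 'cV[K]_N).

Definition stack_cols (s : seq T) : 'M[K]_(N, size s) :=
  \matrix_(i, j) F (tnth (in_tuple s) j) i 0.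

Lemma mul_stack_cols (s : seq T) m (x : 'M[K]_(m, N)) i j :
  (x *m stack_cols s) i j = (x *m F (tnth (in_tuple s) j)) i 0.
Proof. by rewrite !mxE; apply: eq_bigr => k _; rewrite mxE. Qed.

Lemma mul_stack_cols_eq0 (s : seq T) m (x : 'M[K]_(m, N)) :
  x *m stack_cols s = 0 <-> forall t, t \in s -> x *m F t = 0.
Proof.
split=> [xs t ts|xs].
  have [j ->] : exists j, t = tnth (in_tuple s) j by apply/tnthP.
  by apply/colP => i; rewrite -mul_stack_cols xs !mxE.
apply/matrixP => i j; rewrite mul_stack_cols xs ?mxE //.
exact: mem_tnth.
Qed.

(** An equation of [P] not implied by the current list strictly lowers the rank of its kernel when
    added, and that rank is at most N at the start. *)
Lemma finite_cut (P : set T) : exists2 s : seq T, (forall t, t \in s -> P t) &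
  forall x : 'rV[K]_N, x *m stack_cols s = 0 -> forall t, P t -> x *m F t = 0.
Proof.
suff: forall d (s : seq T), (forall t, t \in s -> P t) ->
    (\rank (kermx (stack_cols s)) <= d)%N ->
    exists2 s : seq T, (forall t, t \in s -> P t) &
    forall x : 'rV[K]_N, x *m stack_cols s = 0 -> forall t, P t -> x *m F t = 0.
  by move=> /(_ N [::]); apply=> //; exact: rank_leq_row.
elim=> [|d IH] s sP sd.
  exists s => // x /sub_kermxP; move: sd; rewrite leqn0 mxrank_eq0 => /eqP ->.
  by rewrite submx0 => /eqP -> t _; rewrite mul0mx.
have [h|] := pselect (forall x : 'rV[K]_N, x *m stack_cols s = 0 ->
  forall t, P t -> x *m F t = 0); first by exists s.
move=> /existsNP[x] /not_implyP[xs] /existsNP[t] /not_implyP[Pt xt].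
apply: (IH (t :: s)) => [u|].
  by rewrite inE => /orP[/eqP -> //|]; exact: sP.
rewrite -ltnS; apply: leq_trans sd; apply: rank_ltmx.
rewrite ltmxE; apply/andP; split.
  apply/sub_kermxP/mul_stack_cols_eq0 => u us.
  have /mul_stack_cols_eq0 := mulmx_ker (stack_cols (t :: s)); apply.
  by rewrite inE us orbT.
apply/negP => h; have /submx_trans/(_ h) : (x <= kermx (stack_cols s))%MS.
  exact/sub_kermxP.
move=> /sub_kermxP/mul_stack_cols_eq0/(_ t).
by rewrite inE eqxx => /(_ isT).
Qed.

End FiniteCut.

Section AlgebraicGroup.
Context {R : realType} {n : nat}.
Local Notation C := (Cplx R).
Context (G : set 'M[C]_n) (hG : linear_algebraic_group G).

Local Notation mx_ideal := Defs.mx_ideal.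

(** The equations that define G belong to its full vanishing ideal, so invertible matrices may be
    tested on the latter. *)
Lemma lag_mem (g : 'M[C]_n) : g \in unitmx ->
  (forall p, mx_ideal G p -> meval (mxpt g) p = 0) -> G g.
Proof.
have [I GI] := lag_closed hG => ug gI; rewrite GI; split => // p Ip.
by apply: gI => h; rewrite GI => -[_]; apply.
Qed.

Lemma lag_unit g : G g -> g \in unitmx.
Proof. by have [I ->] := lag_closed hG => -[]. Qed.

Lemma meval_lin (f : {linear 'M[C]_n -> 'M[C]_n}) (Y : 'M[C]_n) k :
  meval (mxpt Y) (tnth (linsub (lin_mx f)) k) = mxpt (f Y) k.
Proof.
rewrite meval_linsub /mxpt -mul_vec_lin mxE.
by apply: eq_bigr => l _; rewrite mulrC.
Qed.

Lemma dder_lin (f : {linear 'M[C]_n -> 'M[C]_n}) (Y V : 'M[C]_n) k :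
  dder (tnth (linsub (lin_mx f)) k) (mxpt Y) (mxpt V) = mxpt (f V) k.
Proof.
rewrite dder_linsub /mxpt -mul_vec_lin mxE.
by apply: eq_bigr => l _; rewrite mulrC.
Qed.

Lemma mx_ideal_comp (f : {linear 'M[C]_n -> 'M[C]_n}) p :
  (forall g, G g -> G (f g)) -> mx_ideal G p ->
  mx_ideal G (comp_mpoly (linsub (lin_mx f)) p).
Proof.
move=> fG Gp g Gg; rewrite comp_mpoly_meval.
rewrite (meval_eq _ (meval_lin f g)).
by apply: Gp; exact: fG.
Qed.

(** Serves twice: with [f] a conjugation it gives stability of Lie G under Ad, and with [f] a left
    translation it moves tangent vectors from 1 to another point of G. *)
Lemma lie_algebra_transport (f : {linear 'M[C]_n -> 'M[C]_n}) X p :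
  (forall g, G g -> G (f g)) -> lie_algebra G X -> mx_ideal G p ->
  dder p (mxpt (f 1%:M)) (mxpt (f X)) = 0.
Proof.
move=> fG GX Gp; rewrite -[RHS](GX _ (mx_ideal_comp fG Gp)).
rewrite -[RHS]/(dder (comp_mpoly (linsub (lin_mx f)) p) (mxpt 1%:M) (mxpt X)).
rewrite dder_comp; apply: dder_eq => k; first by rewrite meval_lin.
by rewrite dder_lin.
Qed.

Lemma lie_algebra_conj u X : G u -> lie_algebra G X ->
  lie_algebra G (u *m X *m invmx u).
Proof.
move=> Gu GX p Gp.
pose f : {linear 'M[C]_n -> 'M[C]_n} := mulmxr (invmx u) \o mulmx u.
rewrite -[LHS]/(dder p (mxpt 1%:M) (mxpt (u *m X *m invmx u))).
have := @lie_algebra_transport f X p _ GX Gp; rewrite /= mulmx1 mulmxV ?lag_unit //.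
apply=> g Gg; apply: lag_mul => //; last exact: lag_inv.
exact: lag_mul.
Qed.

(** The linear vector field here is Y -> YX, the left-invariant field with value X at 1. *)
Lemma meval_lder_right X p (Y : 'M[C]_n) :
  meval (mxpt Y) (lder (lin_mulmxr X) p) = dder p (mxpt Y) (mxpt (Y *m X)).
Proof.
rewrite meval_lder; apply: dder_eq => // k.
by rewrite -meval_linsub (meval_lin (mulmxr X)).
Qed.

Lemma mx_ideal_lder X p : lie_algebra G X -> mx_ideal G p ->
  mx_ideal G (lder (lin_mulmxr X) p).
Proof.
move=> GX Gp u Gu; rewrite meval_lder_right.
have := @lie_algebra_transport (mulmx u) X p _ GX Gp; rewrite /= mulmx1.
by apply=> g Gg; exact: lag_mul.
Qed.

(* All derivatives of p (exp (t X)) at t = 0 are values at 1 of elements of the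
   ideal of G. *)
Lemma expmx_lie X : lie_algebra G X -> G (expmx X).
Proof.
move=> GX; apply: lag_mem; first exact: expmx_unit.
move=> p Gp.
have Gk k : mx_ideal G (iter k (lder (lin_mulmxr X)) p).
  by elim: k => [//|k IH]; rewrite iterS; exact: mx_ideal_lder.
pose B : R := n.+1%:R * expR (nrm X).
have B0 : 0 <= B by rewrite mulr_ge0 ?expR_ge0.
have [K [r [K0 r0 hK]]] := iter_lder_le (lin_mulmxr X) p B0.
rewrite -[X in expmx X]scale1r.
apply: (@flat_complex R (fun k s => meval (mxpt (expmx (s *: X)))
   (iter k (lder (lin_mulmxr X)) p)) K r).
- move=> k t.
  have ed i : is_derive t (1 : C) (fun s => mxpt (expmx (s *: X)) i)
      (mxpt (X *m expmx (t *: X)) i).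
    rewrite /mxpt; case/mxvec_indexP: i => i j; rewrite mxvecE.
    rewrite (_ : (fun s => _) = fun s => expmx (s *: X) i j).
      exact: is_derive_expmx.
    by apply/funext => s; rewrite mxvecE.
  apply: is_derive_eq (is_derive_meval (iter k (lder (lin_mulmxr X)) p) ed) _.
  (* The velocity X exp (tX) must be written exp (tX) X to be the value of the left-invariant
     field. *)
  by rewrite expmx_comm -meval_lder_right.
- by move=> k; rewrite scale0r expmx0; apply: Gk; exact: lag_one.
- move=> k t /andP[t0 t1]; apply: hK => i; rewrite /mxpt.
  case/mxvec_indexP: i => i j; rewrite mxvecE.
  apply: le_trans (cabs_le_nrm _ _ _) _; apply: le_trans (nrm_expmx_le _) _.
  rewrite /B ler_wpM2l // ler_expR nrmZ cabs_real ger0_norm //.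
  by rewrite ler_piMl ?nrm_ge0.
Qed.

End AlgebraicGroup.

(** * Elements of G near the identity, and induction along a connected group *)

Lemma near_identity_id1 (V : zmodType) (x z e f : V) :
  z + (e - x - (f - (x - z))) = e - f.
Proof.
have -> : f - (x - z) = f + z - x by rewrite opprB addrA.
have -> : e - x - (f + z - x) = e - (f + z) by rewrite opprB addrA subrK.
by rewrite addrC opprD addrA subrK.
Qed.

Lemma near_identity_id2 (V : zmodType) (a z w : V) :
  a - z = w + (a - (z + w)).
Proof. by rewrite [RHS]addrC opprD addrA subrK. Qed.

Section NearIdentity.
Context {R : realType} {n : nat}.
Local Notation C := (Cplx R).
Local Notation mx_ideal := Defs.mx_ideal.
Context (G : set 'M[C]_n) (hG : linear_algebraic_group G).

Lemma vnrm_mxpt (D : 'M[C]_n) : vnrm (mxpt D) = nrm D.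
Proof.
rewrite /vnrm /nrm /mxpt pair_big /=.
rewrite (reindex _ (curry_mxvec_bij n n)) /=.
by apply: eq_bigr => -[i j] _; rewrite mxvecE.
Qed.

Lemma nrm_mxvec (D : 'M[C]_n) : nrm (mxvec D) = nrm D.
Proof. by rewrite -vnrm_mxpt /nrm big_ord1. Qed.

Definition grad1 (p : mpoly (n * n) C) : 'cV[C]_(n * n) :=
  \col_k meval (mxpt 1%:M) (mderiv k p).

Lemma mul_grad1 (D : 'M[C]_n) p :
  (mxvec D *m grad1 p) 0 0 = dder p (mxpt 1%:M) (mxpt D).
Proof. by rewrite mxE; apply: eq_bigr => k _; rewrite mxE mulrC. Qed.

(* Finitely many equations cut out Lie G, and along G they vanish to second
   order at 1. *)
Lemma lie_algebra_cut : exists (m : nat) (A : 'M[C]_(n * n, m)) (K : R),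
  [/\ 0 <= K, forall X, mxvec X *m A = 0 -> lie_algebra G X &
      forall D, G (1%:M + D) -> nrm D <= 1 ->
        nrm (mxvec D *m A) <= K * nrm D ^+ 2].
Proof.
have [s sG sL] := finite_cut grad1 (mx_ideal G).
have hp (p : mpoly (n * n) C) : exists K : R, 0 <= K /\
    (mx_ideal G p -> forall D, G (1%:M + D) -> nrm D <= 1 ->
      cabs (dder p (mxpt 1%:M) (mxpt D)) <= K * nrm D ^+ 2).
  have [K K0 h] := meval_taylor2 p (mxpt 1%:M).
  exists K; split => // Gp D GD D1.
  have := h (mxpt D); rewrite vnrm_mxpt => /(_ D1).
  (* As p vanishes at 1 and at 1 + D, the second-order Taylor remainder is minus the differential
     itself. *)
  rewrite (Gp _ (lag_one hG)) subr0.
  rewrite (@meval_eq _ _ _ (mxpt (1%:M + D))); last first.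
    by move=> i; rewrite /mxpt linearD mxE.
  by rewrite (Gp _ GD) sub0r cabsN.
have [K hK] := choice hp.
exists (size s), (stack_cols grad1 s),
  (\sum_(j < size s) K (tnth (in_tuple s) j)); split.
- by apply: sumr_ge0 => j _; have [] := hK (tnth (in_tuple s) j).
- move=> X /sL h p Gp.
  rewrite -[LHS]/(dder p (mxpt 1%:M) (mxpt X)) -mul_grad1.
  by rewrite h // mxE.
move=> D GD D1; rewrite /nrm big_ord1 mulr_suml; apply: ler_sum => j _.
rewrite mul_stack_cols mul_grad1.
have [_] := hK (tnth (in_tuple s) j); apply => //.
by apply: sG; exact: mem_tnth.
Qed.

(** [r = 2 / (8 + 4 * B)] meets the last two bounds, and [e] solves 2e(1 + c) = r. Here [c] bounds Z
    by X, [2 * e] bounds X, and [r] will bound X, Y and Z together. *)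
Lemma near_identity_consts (c B : R) : 0 <= c -> 0 <= B ->
  exists e r : R, [/\ 0 < e, e <= 8^-1, 2 * e * (1 + c) <= r, r <= 4^-1 &
    r * B <= 2^-1].
Proof.
move=> c0 B0; exists (((1 + c) * (8 + 4 * B))^-1), (2 / (8 + 4 * B)).
have h1 : 0 < 1 + c by rewrite ltr_wpDr.
have h2 : 0 < 8 + 4 * B by rewrite ltr_wpDr ?mulr_ge0.
split.
- by rewrite invr_gt0 mulr_gt0.
- rewrite lef_pV2 ?posrE ?mulr_gt0 //.
  by rewrite -[leLHS]mul1r ler_pM ?lerDl ?mulr_ge0.
- rewrite le_eqVlt; apply/orP; left; apply/eqP; field.
  by rewrite !gt_eqF.
- by rewrite ler_pdivrMr // ; lra.
- by rewrite mulrAC ler_pdivrMr //; lra.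
Qed.

(** With [z] the norm of Z and [zA] that of its image under the equations, the bounds combine to z
    <= r c (16K + 6l) z, hence to z <= z / 2. *)
Lemma near_identity_absurd (c K l r z zA : R) : 0 <= c -> 0 <= K -> 0 <= l ->
  0 <= r -> 0 <= z -> z <= r ->
  zA <= K * (4 * z) ^+ 2 + 6 * r * z * l ->
  z <= zA * c -> r * (c * (16 * K + 6 * l)) <= 2^-1 -> z <= 0.
Proof.
move=> c0 K0 l0 r0 z0 zr hA hz hB.
have h1 : z <= (K * (4 * z) ^+ 2 + 6 * r * z * l) * c.
  by apply: le_trans hz _; rewrite ler_wpM2r.
have h2 : K * (4 * z) ^+ 2 <= 16 * K * r * z.
  rewrite exprMn -natrX [K * _]mulrCA -[(4 ^ 2)%N]/16%N -!mulrA ler_wpM2l //.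
  by rewrite ler_wpM2l // expr2 ler_wpM2r.
have h3 : z <= (16 * K * r * z + 6 * r * z * l) * c.
  by apply: le_trans h1 _; rewrite ler_wpM2r // lerD2r.
have h4 : (16 * K * r * z + 6 * r * z * l) * c = r * (c * (16 * K + 6 * l)) * z.
  by ring.
rewrite h4 in h3.
have h5 : z <= 2^-1 * z by apply: le_trans h3 _; rewrite ler_wpM2r.
by lra.
Qed.

Lemma near_identity_expmx : exists2 e : R, 0 < e &
  forall g, G g -> nrm (g - 1%:M) <= e ->
    exists2 X, lie_algebra G X & expmx X = g.
Proof.
have [m [A [K [K0 AL AG]]]] := lie_algebra_cut.
pose P := pinvmx A.
have [||e [r [e0 e8 er r4 rB]]] := @near_identity_consts (nrm A * nrm P)
   (nrm P * (16 * K + 6 * nrm A)).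
- by rewrite mulr_ge0 ?nrm_ge0.
- by rewrite mulr_ge0 ?addr_ge0 ?mulr_ge0 ?nrm_ge0.
exists e => // g Gg ge; have [X Xe Xg] := expmx_surj e8 ge.
have c0 : 0 <= nrm A * nrm P by rewrite mulr_ge0 ?nrm_ge0.
(* Since A P A = A, the matrices X and Z have the same image under A, so X - Z satisfies the
   equations of Lie G. Moreover Z = Z A P bounds Z by its image under A. *)
pose Z : 'M[C]_n := vec_mx (mxvec X *m A *m P).
have ZA : mxvec Z *m A = mxvec X *m A.
  by rewrite /Z vec_mxK mulmxKpV // submxMl.
have Zz : nrm Z <= nrm (mxvec Z *m A) * nrm P.
  have ZE : mxvec Z = mxvec Z *m A *m P by rewrite ZA /Z vec_mxK.
  by rewrite -[in leLHS]nrm_mxvec [in leLHS]ZE; exact: ler_nrmM.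
have ZX : nrm Z <= nrm X * (nrm A * nrm P).
  apply: le_trans Zz _; rewrite ZA mulrA ler_wpM2r ?nrm_ge0 //.
  by rewrite -(nrm_mxvec X); exact: ler_nrmM.
pose Y := X - Z.
have GY : lie_algebra G Y.
  by apply: AL; rewrite /Y linearB mulmxBl ZA subrr.
have r0 : 0 <= r by apply: le_trans er; rewrite !mulr_ge0 ?addr_ge0 ?(ltW e0).
have er' : nrm X * (1 + nrm A * nrm P) <= r.
  by apply: le_trans er; rewrite ler_wpM2r ?addr_ge0.
have Xr : nrm X <= r.
  by apply: le_trans er'; rewrite ler_peMr ?nrm_ge0 // lerDl.
have Zr : nrm Z <= r.
  apply: le_trans ZX _; apply: le_trans er'.
  by rewrite ler_wpM2l ?nrm_ge0 // lerDr.
have Yr : nrm Y <= r.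
  apply: le_trans (ler_nrmB _ _) _; apply: le_trans er'.
  by rewrite mulrDr mulr1 lerD2l.
have r2 : r <= 2^-1 by lra.
pose W := (expmx X - X) - (expmx Y - Y).
have Wz : nrm W <= 2 * r * nrm Z.
  have XY : X - Y = Z by rewrite /Y opprB addrC subrK.
  by rewrite -XY; exact: expmx_lipschitz2.
pose E := expmx (- Y) - 1%:M.
have Er : nrm E <= 2 * r.
  apply: (@le_trans _ _ (2 * nrm (- Y))); last by rewrite nrmN ler_wpM2l.
  by apply: expmx_sub1; rewrite nrmN; apply: le_trans Yr r2.
pose D := expmx (- Y) *m g - 1%:M.
(* The identity is exp (-Y) (exp X - exp Y) = (1 + E)(Z + W), where E and W are small multiples of r
   and of r |Z| respectively. *)
have DE : D - Z = W + E *m (Z + W).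
  have ZW : Z + W = g - expmx Y.
    by rewrite -Xg; exact: (near_identity_id1 X Z (expmx X) (expmx Y)).
  have D1 : D = expmx (- Y) *m (g - expmx Y).
    rewrite mulmxBr; congr (_ - _).
    by have := expmxNK (- Y); rewrite opprK => ->.
  by rewrite D1 -ZW /E mulmxBl mul1mx; exact: near_identity_id2.
(* 6 = 2 + 2 * 2, from |W| <= 2r|Z|, |E| <= 2r and |Z + W| <= 2|Z|. *)
have DZ : nrm (D - Z) <= 6 * r * nrm Z.
  rewrite DE; apply: le_trans (ler_nrmD _ _) _.
  have h : nrm (E *m (Z + W)) <= 2 * r * (2 * nrm Z).
    apply: le_trans (ler_nrmM _ _) _; rewrite ler_pM ?nrm_ge0 //.
    apply: le_trans (ler_nrmD _ _) _.
    rewrite mulrDl mul1r lerD2l; apply: le_trans Wz _.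
    by rewrite ler_piMl ?nrm_ge0 //; lra.
  by apply: le_trans (lerD Wz h) _; lra.
have D4 : nrm D <= 4 * nrm Z.
  rewrite -(subrK Z D); apply: le_trans (ler_nrmD _ _) _.
  apply: le_trans (lerD DZ (lexx _)) _.
  have : 6 * r * nrm Z <= 3 * nrm Z by rewrite ler_wpM2r ?nrm_ge0 //; lra.
  by lra.
have D1 : nrm D <= 1.
  by apply: le_trans D4 _; move: Zr r4; lra.
have GD : G (1%:M + D).
  rewrite /D addrC subrK; apply: lag_mul => //; apply: expmx_lie => //.
  by apply: AL; rewrite linearN mulNmx /Y linearB mulmxBl ZA subrr oppr0.
have hD := AG D GD D1.
suff Z0 : Z = 0.
  by exists X => //; move: GY; rewrite /Y Z0 subr0.
apply: nrm_le0.
apply: (@near_identity_absurd (nrm P) K (nrm A) r (nrm Z) (nrm (mxvec Z *m A)));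
  rewrite ?nrm_ge0 //.
have -> : mxvec Z = mxvec D - mxvec (D - Z) by rewrite -linearB subKr.
rewrite mulmxBl; apply: le_trans (ler_nrmB _ _) _.
apply: lerD.
  apply: le_trans hD _; rewrite ler_wpM2l //.
  by rewrite lerXn2r ?nnegrE ?mulr_ge0 ?nrm_ge0.
by apply: le_trans (ler_nrmM _ _) _; rewrite nrm_mxvec ler_wpM2r ?nrm_ge0.
Qed.

(** [P] is relatively open and closed in G: the elements of G near u have the form u exp X, and [P]
    crosses this step in both directions because X may be replaced by -X. *)
Lemma connected_lag_ind (P : set 'M[C]_n) : connected G -> P 1%:M ->
  (forall u X, G u -> P u -> lie_algebra G X -> P (u *m expmx X)) ->
  forall u, G u -> P u.
Proof.
move=> cG P1 PX; have [e e0 He] := near_identity_expmx.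
(* The union of the translates by elements u of [G] and [S] of the ball of radius [e] around 1, an
   open set of matrices whose trace on G is used. *)
pose near_of (S : set 'M[C]_n) : set 'M[C]_n :=
  [set v | exists u, [/\ G u, S u & nrm (invmx u *m v - 1%:M) < e]].
have near_open S : open (near_of S).
  rewrite openE => v [u [Gu Su uv]].
  pose d := (e - nrm (invmx u *m v - 1%:M)) / (nrm (invmx u) + 1).
  have q0 : 0 < nrm (invmx u) + 1 by rewrite ltr_wpDl ?nrm_ge0.
  have d0 : 0 < d by rewrite divr_gt0 // subr_gt0.
  apply: filterS (nbhs_nrm v d0) => v' /= vv'; exists u; split => //.
  rewrite -(subrK (invmx u *m v) (invmx u *m v')) -mulmxBr -addrA.
  apply: le_lt_trans (ler_nrmD _ _) _; rewrite -ltrBrDr.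
  apply: le_lt_trans (ler_nrmM _ _) _.
  apply: (@le_lt_trans _ _ ((nrm (invmx u) + 1) * nrm (v' - v))).
    by rewrite ler_wpM2r ?nrm_ge0 // lerDl.
  by rewrite mulrC -ltr_pdivlMr.
have near_exp u v : G u -> G v -> nrm (invmx u *m v - 1%:M) < e ->
    exists2 X, lie_algebra G X & v = u *m expmx X.
  move=> Gu Gv uv; have [||X GX Xe] := He (invmx u *m v); last first.
  - by exists X => //; rewrite Xe mulKVmx // (lag_unit hG).
  - exact: ltW.
  - by apply: lag_mul => //; exact: lag_inv.
have near_self (S : set 'M[C]_n) u : G u -> S u -> near_of S u.
  move=> Gu Su; exists u; split => //.
  by rewrite mulVmx ?subrr ?nrm0 // (lag_unit hG).
have Plie u X : G u -> lie_algebra G X -> P (u *m expmx X) -> P u.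
  move=> Gu GX Pu.
  have GNX : lie_algebra G (- X).
    move=> p Gp; have := GX p Gp => /(congr1 -%R); rewrite oppr0 -sumrN; apply: etrans.
    by apply: eq_bigr => k _; rewrite /mxpt linearN mxE mulrN.
  have := PX _ _ _ Pu GNX; rewrite -mulmxA expmxNK mulmx1; apply.
  by apply: lag_mul => //; exact: expmx_lie.
suff : G `&` P = G by move=> <- u [].
apply: cG.
- by exists 1%:M; split => //; exact: lag_one.
- exists (near_of P) => //; apply/seteqP; split=> v [Gv].
    by move=> Pv; split => //; exact: near_self.
  move=> [u [Gu Pu uv]]; split => //.
  by have [X GX ->] := near_exp u v Gu Gv uv; exact: PX.
exists (~` near_of (~` P)); first by rewrite closedC.
apply/seteqP; split=> v [Gv].
  move=> Pv; split => // -[u [Gu nPu uv]]; apply: nPu.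
  have [X GX vX] := near_exp u v Gu Gv uv.
  by apply: (Plie u X) => //; rewrite -vX.
move=> nv; split => //; apply: contrapT => nPv; apply: nv.
exact: near_self.
Qed.

End NearIdentity.

(** * Curves in vector spaces *)

Section VectorDerivatives.
Context {R : realType}.
Local Notation C := (Cplx R).
Implicit Types V W Z : vectType C.

(** Testing on all functionals avoids a choice of coordinates and makes the rule for linear maps a
    mere composition. *)
Definition vderive V (F : C -> V) (dF : V) (t : C) : Prop :=
  forall phi : 'Hom(V, C^o), is_derive t (1 : C) (fun s => phi (F s) : C) (phi dF : C).

Definition vcoord V (i : 'I_(\dim {:V})) : 'Hom(V, C^o) :=
  linfun (coord (vbasis {:V}) i).

Lemma vcoordE V (x : V) : x = \sum_i vcoord i x *: (vbasis {:V})`_i.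
Proof.
rewrite {1}(coord_vbasis (memvf x)); apply: eq_bigr => i _.
by rewrite /vcoord lfunE.
Qed.

Lemma vderive_eq V (F : C -> V) dF dF' t :
  vderive F dF t -> dF = dF' -> vderive F dF' t.
Proof. by move=> ? <-. Qed.

Lemma vderive_cst V (v : V) t : vderive (fun=> v) 0 t.
Proof. by move=> phi; rewrite linear0; exact: is_derive_cst. Qed.

Lemma vderiveD V (F G : C -> V) dF dG t : vderive F dF t -> vderive G dG t ->
  vderive (fun s => F s + G s) (dF + dG) t.
Proof.
move=> Fd Gd phi; rewrite linearD (_ : (fun s => _) = fun s => phi (F s) + phi (G s)).
  exact: (is_deriveDc (Fd phi) (Gd phi)).
by apply/funext => s; rewrite linearD.
Qed.

Lemma vderive_lin V W (f : 'Hom(V, W)) (F : C -> V) dF t :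
  vderive F dF t -> vderive (fun s => f (F s)) (f dF) t.
Proof.
move=> Fd phi; have := Fd (phi \o f)%VF; rewrite comp_lfunE.
by congr is_derive; apply/funext => s; rewrite comp_lfunE.
Qed.

Lemma vderiveB V (F G : C -> V) dF dG t : vderive F dF t -> vderive G dG t ->
  vderive (fun s => F s - G s) (dF - dG) t.
Proof.
move=> Fd Gd; apply: vderiveD => //.
have := vderive_lin (- \1)%VF Gd; rewrite opp_lfunE id_lfunE.
congr vderive; apply/funext => s.
by rewrite opp_lfunE id_lfunE.
Qed.

Lemma vderive_bil V W Z (b : 'Hom(V, 'Hom(W, Z))) (F : C -> V) (G : C -> W) dF dG t :
  vderive F dF t -> vderive G dG t ->
  vderive (fun s => b (F s) (G s)) (b dF (G t) + b (F t) dG) t.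
Proof.
move=> Fd Gd phi.
have bE x y : phi (b x y) = \sum_i \sum_j
    (vcoord i x * vcoord j y) * phi (b (vbasis {:V})`_i (vbasis {:W})`_j) :> C.
  rewrite {1}(vcoordE x) linear_sum sum_lfunE linear_sum; apply: eq_bigr => i _.
  rewrite {1}(vcoordE y) linearZ scale_lfunE linear_sum scaler_sumr linear_sum.
  by apply: eq_bigr => j _; rewrite !linearZ /= scalerA.
rewrite (_ : (fun s => _) = fun s => \sum_i \sum_j
    (vcoord i (F s) * vcoord j (G s)) * phi (b (vbasis {:V})`_i (vbasis {:W})`_j)).
  rewrite linearD /= !bE -big_split /=.
  apply: is_derive_bigsum => i; rewrite -big_split /=.
  apply: is_derive_bigsum => j.
  set c := phi _; rewrite -mulrDl mulrC.
  rewrite (_ : (fun s => _) = fun s => c * (vcoord i (F s) * vcoord j (G s))).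
    by apply: is_deriveCM; apply: is_deriveMc; [exact: Fd|exact: Gd].
  by apply/funext => s; rewrite mulrC.
by apply/funext => s.
Qed.

Lemma vderive0_cst V (F : C -> V) : (forall t, vderive F 0 t) -> F 1 = F 0.
Proof.
move=> F0; rewrite (vcoordE (F 1)) (vcoordE (F 0)); apply: eq_bigr => i _.
congr (_ *: _); apply: (derive0_cst (f := fun s => vcoord i (F s))) => t.
by have := F0 t (vcoord i); rewrite linear0.
Qed.

Lemma vderive_mx m n (F : C -> 'M[C]_(m, n)) (dF : 'M[C]_(m, n)) t :
  (forall i j, is_derive t (1 : C) (fun s => F s i j) (dF i j)) ->
  vderive F dF t.
Proof.
move=> Fd phi.
have E (A : 'M[C]_(m, n)) : phi A = \sum_i \sum_j A i j * phi (delta_mx i j) :> C.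
  rewrite {1}(matrix_sum_delta A) linear_sum; apply: eq_bigr => i _.
  by rewrite linear_sum; apply: eq_bigr => j _; rewrite linearZ.
rewrite E (_ : (fun s => _) = fun s => \sum_i \sum_j F s i j * phi (delta_mx i j)).
  apply: is_derive_bigsum => i; apply: is_derive_bigsum => j.
  rewrite mulrC (_ : (fun s => _) = fun s => phi (delta_mx i j) * F s i j).
    exact: is_deriveCM.
  by apply/funext => s; rewrite mulrC.
by apply/funext => s.
Qed.

Lemma vderive_mx_entry m n (F : C -> 'M[C]_(m, n)) (dF : 'M[C]_(m, n)) t i j :
  vderive F dF t -> is_derive t (1 : C) (fun s => F s i j) (dF i j).
Proof.
move=> Fd.
have lin : linear (fun A : 'M[C]_(m, n) => A i j : C^o).
  by move=> a A B; rewrite !mxE.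
have := Fd (linfun (fun A : 'M[C]_(m, n) => A i j : C^o)).
rewrite linfun_lin //; congr is_derive; apply/funext => s.
by rewrite linfun_lin.
Qed.

(** Taking an entry is continuous, so the derivative of the coordinate vector passes to each
    coordinate, and every functional is a combination of these. *)
Lemma vderive_curve V (xi : V -> V) (c : C -> V) t :
  integral_curve xi c -> vderive c (xi (c t)) t.
Proof.
move=> /(_ t) cd phi.
have rvd i : is_derive t (1 : C) (fun s => rv (c s) 0 i) (rv (xi (c t)) 0 i).
  pose u (s : C) := rv (c s).
  have cv : (fun h : C => h^-1 *: (u (h *: (1 : C) + t) - u t)) @ 0^' -->
      rv (xi (c t)).
    by have [cd1 <-] := cd; exact: cd1.
  have cvi : (fun h : C => h^-1 *: (u (h *: (1 : C) + t) 0 i - u t 0 i)) @ 0^' -->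
      rv (xi (c t)) 0 i.
    have -> : (fun h : C => h^-1 *: (u (h *: (1 : C) + t) 0 i - u t 0 i)) =
        (fun A : 'rV[C]_(\dim {:V}) => A 0 i) \o
          (fun h : C => h^-1 *: (u (h *: (1 : C) + t) - u t)).
      by apply/funext => h; rewrite /= !mxE.
    exact: continuous_cvg (@coord_continuous C 1 (\dim {:V}) 0 i _) cv.
  apply: DeriveDef; first by apply/cvg_ex; exists (rv (xi (c t)) 0 i).
  exact: (cvg_lim (@norm_hausdorff C C) cvi).
have E (x : V) : phi x = \sum_i rv x 0 i * phi (vbasis {:V})`_i :> C.
  rewrite {1}(coord_vbasis (memvf x)) linear_sum; apply: eq_bigr => i _.
  by rewrite linearZ /rv mxE.
rewrite E (_ : (fun s => _) = fun s => \sum_i rv (c s) 0 i * phi (vbasis {:V})`_i).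
  apply: is_derive_bigsum => i.
  rewrite mulrC (_ : (fun s => _) = fun s => (phi (vbasis {:V})`_i : C) * rv (c s) 0 i).
    exact: is_deriveCM.
  by apply/funext => s; rewrite mulrC.
by apply/funext => s.
Qed.

End VectorDerivatives.

(** * The gauge action *)

Lemma scale_half_double (K : numFieldType) (V : lmodType K) (v : V) :
  2^-1 *: (v + v) = v.
Proof. by rewrite -mulr2n -(scaler_nat 2 v) scalerA mulVf ?pnatr_eq0 // scale1r. Qed.

Section ConjugationDerivative.
Context {K : comNzRingType} {n : nat}.
Implicit Types X B E F W : 'M[K]_n.

(** [E] and [F] stand for exp (tX) and exp (-tX); the left side is the Leibniz derivative of E B
    F. *)
Lemma conj_derivE X B E F : X *m F = F *m X ->
  (X *m E *m B + E *m 0) *m F + E *m B *m (- (X *m F)) =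
  X *m (E *m B *m F) - E *m B *m F *m X.
Proof. by move=> FX; rewrite mulmx0 addr0 mulmxN FX !mulmxA. Qed.

Lemma conj_deriv_eq0 X E F W : X *m F = F *m X ->
  (- (X *m F) *m W + F *m (X *m W - W *m X)) *m E + F *m W *m (X *m E) = 0.
Proof.
move=> FX; rewrite FX mulNmx mulmxBr !mulmxA addrA addNr add0r mulNmx.
exact: addNr.
Qed.

Lemma conj_cancel E F W : E *m F = 1%:M -> W = E *m (F *m W *m E) *m F.
Proof. by move=> EF; rewrite !mulmxA EF mul1mx -mulmxA EF mulmx1. Qed.

End ConjugationDerivative.

Section SubspaceValue.
Context {K : fieldType} {V : vectType K} (U : {vspace V}).
Implicit Types x y : subvs_of U.

Lemma vsvalD x y : vsval (x + y) = vsval x + vsval y.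
Proof. exact: linearD. Qed.

Lemma vsvalN x : vsval (- x) = - vsval x.
Proof. exact: linearN. Qed.

Lemma vsval0 : vsval (0 : subvs_of U) = 0.
Proof. exact: linear0. Qed.

End SubspaceValue.

Section GaugeAlgebra.
Context {R : realType}.
Local Notation C := (Cplx R).
Context {L : vectType C} (g : dgLieSuper L).
Local Notation ev := (hpart g false).
Local Notation od := (hpart g true).
Local Notation ad0 := (hbr g false false).
Local Notation ad1 := (hbr g false true).
Local Notation brk := (hbr g true true).
Implicit Types (a b c : ev) (x y z : od).

(* [hbrE] at fixed parities: its own statement mentions [a (+) b], which does
   not unify with a literal parity. *)
Lemma ad0E a b : vsval (ad0 a b : ev) = br g (vsval a) (vsval b).
Proof. exact: (hbrE (g := g) (a := false) (b := false)). Qed.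

Lemma ad1E a x : vsval (ad1 a x : od) = br g (vsval a) (vsval x).
Proof. exact: (hbrE (g := g) (a := false) (b := true)). Qed.

Lemma brkE x y : vsval (brk x y : ev) = br g (vsval x) (vsval y).
Proof. exact: (hbrE (g := g) (a := true) (b := true)). Qed.

Lemma dif0E a : vsval (hdif g false a : od) = dif g (vsval a).
Proof. exact: (hdifE (g := g) (a := false)). Qed.

Lemma dif1E x : vsval (hdif g true x : ev) = dif g (vsval x).
Proof. exact: (hdifE (g := g) (a := true)). Qed.

Let brE := (ad0E, ad1E, brkE, dif0E, dif1E).

Lemma dPhiE x y : dPhi g x y = hdif g true y + brk x y.
Proof. by rewrite /dPhi add_lfunE. Qed.

Lemma brkC x y : brk x y = brk y x.
Proof.
apply: subvs_inj; rewrite !brE (br_skew (subvsP x) (subvsP y)) /=.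
by rewrite expr1 scaleN1r opprK.
Qed.

Lemma ad0C a b : ad0 a b = - ad0 b a.
Proof.
apply: subvs_inj; rewrite vsvalN !brE (br_skew (subvsP a) (subvsP b)) /=.
by rewrite expr0 scale1r.
Qed.

Lemma ad_brk a x y : ad0 a (brk x y) = brk (ad1 a x) y + brk x (ad1 a y).
Proof.
apply: subvs_inj; rewrite vsvalD !brE.
by rewrite (br_jacobi (subvsP a) (subvsP x) (subvsP y)) /= expr0 scale1r.
Qed.

Lemma dif_ad1 a x :
  hdif g true (ad1 a x) = brk (hdif g false a) x + ad0 a (hdif g true x).
Proof.
apply: subvs_inj; rewrite vsvalD !brE.
by rewrite (dif_br (subvsP a) (subvsP x)) expr0 scale1r.
Qed.

Lemma dif_dif0 a : hdif g true (hdif g false a) = 0.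
Proof. by apply: subvs_inj; rewrite !brE dif_dif vsval0. Qed.

(** Expanding with d^2 = 0, the terms [da, x] and [x, da] cancel since the bracket is symmetric on
    odd elements, and [x, [a, x]] is half of [a, [x, x]] by Jacobi. *)
Lemma dPhi_xi a x : dPhi g x (xi g a x) = ad0 a (Phi g x).
Proof.
rewrite dPhiE /xi /Phi !linearB /= dif_dif0 subr0 dif_ad1 linearD linearZ /=.
rewrite ad_brk (brkC (ad1 a x)) scale_half_double.
by rewrite (brkC (hdif g false a)) [brk x _ + _]addrC addrACA subrr addr0.
Qed.

Lemma Phi_taylor x y :
  Phi g (x + y) = Phi g x + dPhi g x y + 2^-1 *: brk y y.
Proof.
have e1 : hdif g true (x + y) = hdif g true x + hdif g true y := linearD _ _ _.
have e2 : brk (x + y) (x + y) = brk x x + (brk x y + brk x y) + brk y y.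
  have e0 : brk (x + y) = (brk x + brk y)%R := linearD _ _ _.
  by rewrite e0 add_lfunE !linearD /= (brkC y x) !addrA.
rewrite /Phi dPhiE e1 e2 scalerDr (scalerDr _ _ (brk x y + brk x y)).
rewrite scale_half_double !addrA; congr (_ + _ + _).
by rewrite addrAC.
Qed.

Section Form.
Context (beta : 'Hom(L, 'Hom(L, C^o))) (hb : even_invariant_form g beta).
Local Notation w := (omega g beta).
Local Notation k := (kappa_ev g beta).

Lemma omegaE x y : w x y = beta (vsval x) (vsval y).
Proof. exact: hformE. Qed.

Lemma kappaE a b : k a b = beta (vsval a) (vsval b).
Proof. exact: hformE. Qed.

Lemma omega_alt x : w x x = 0.
Proof.
rewrite omegaE; have := form_skew hb (subvsP x) (subvsP x).
move/eqP; rewrite -subr_eq0 opprK -mulr2n mulrn_eq0 /=.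
by move/eqP.
Qed.

Lemma omega_skew x y : w x y = - w y x.
Proof. by rewrite !omegaE (form_skew hb (subvsP x) (subvsP y)). Qed.

Lemma omega_ad a x y : w (ad1 a x) y = beta (vsval a) (vsval (brk x y)).
Proof.
by rewrite omegaE !brE (form_br hb (subvsP a) (subvsP x) (subvsP y)).
Qed.

(** The bracket term comes from the invariance of beta, the translation term from beta(da, y) = -
    beta(a, dy) for even a. *)
Lemma omega_xi a x y : w (xi g a x) y = beta (vsval a) (vsval (dPhi g x y)).
Proof.
have e : w (xi g a x) = (w (ad1 a x) - w (hdif g false a))%R := linearB _ _ _.
rewrite e add_lfunE opp_lfunE omega_ad omegaE dPhiE.
have := form_dif hb (subvsP a) (subvsP y); rewrite expr0 mul1r -!brE => /eqP.
rewrite addr_eq0 => /eqP ->.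
by rewrite opprK addrC vsvalD linearD.
Qed.

(** omega([a, x], y) = beta(a, [x, y]) is symmetric in x and y, whereas omega is skew. *)
Lemma omega_invariant a x y : w (ad1 a x) y + w x (ad1 a y) = 0.
Proof.
by rewrite [w x _]omega_skew !omega_ad brkC subrr.
Qed.

Lemma kappa_sym a b : k a b = k b a.
Proof. by rewrite !kappaE (form_sym hb (subvsP a) (subvsP b)). Qed.

Lemma kappa_invariant c a b : k (ad0 c a) b + k a (ad0 c b) = 0.
Proof.
have e : k (- ad0 a c) = (- k (ad0 a c))%R := linearN _ _.
rewrite (ad0C c a) e opp_lfunE !kappaE !brE.
by rewrite (form_br hb (subvsP a) (subvsP c) (subvsP b)) addNr.
Qed.

End Form.
End GaugeAlgebra.

Section GaugeAction.
Context {R : realType}.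
Local Notation C := (Cplx R).
Context {L : vectType C} (g : dgLieSuper L).
Context {n : nat} (G : set 'M[C]_n) (hG : linear_algebraic_group G).
Context (lam : 'Hom(hpart g false, 'M[C]_n)) (hlam : lie_algebra_iso G lam).
Local Notation ev := (hpart g false).
Local Notation od := (hpart g true).
Local Notation ad0 := (hbr g false false).
Local Notation ad1 := (hbr g false true).
Local Notation Adl := (Ad lam).

Lemma lamK : cancel lam (lam^-1)%VF.
Proof. by apply: lker0_lfunK; apply/eqP; exact: lie_inj hlam. Qed.

Lemma lam_inj : injective lam.
Proof. exact: can_inj lamK. Qed.

Lemma lam_lie a : lie_algebra G (lam a).
Proof. by apply/(lie_img hlam); exact: memv_img (memvf a). Qed.

Lemma lamVK X : lie_algebra G X -> lam ((lam^-1)%VF X) = X.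
Proof. by move=> /(lie_img hlam); exact: limg_lfunVK. Qed.

(** [Ad] is defined through the total inverse of [lam], which is meaningful only on Lie G;
    conjugation by elements of G stays there. *)
Lemma lam_Ad u a : G u -> lam (Adl u a) = u *m lam a *m invmx u.
Proof. by move=> Gu; apply: lamVK; apply: lie_algebra_conj => //; exact: lam_lie. Qed.

Lemma invmx_mul (u v : 'M[C]_n) : u \in unitmx -> v \in unitmx ->
  invmx (u *m v) = invmx v *m invmx u.
Proof.
move=> uu uv; have uuv : u *m v \in unitmx by rewrite unitmx_mul uu.
rewrite -[RHS](mulKmx uuv) -[LHS]mulmx1; congr (_ *m _).
by rewrite mulmxA -(mulmxA u) mulmxV // mulmx1 mulmxV.
Qed.

Lemma Ad_mul u v a : G u -> G v -> Adl (u *m v) a = Adl u (Adl v a).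
Proof.
move=> Gu Gv; apply: lam_inj; rewrite !lam_Ad //; last exact: lag_mul.
by rewrite (invmx_mul (lag_unit hG Gu) (lag_unit hG Gv)) !mulmxA.
Qed.

Lemma Ad1 a : Adl 1%:M a = a.
Proof.
apply: lam_inj; rewrite lam_Ad; last exact: lag_one.
by rewrite invmx1 mul1mx mulmx1.
Qed.

Lemma G_exp a : G (expmx (lam a)).
Proof. by apply: expmx_lie => //; exact: lam_lie. Qed.

Lemma G_expZ (t : C) a : G (expmx (t *: lam a)).
Proof. by rewrite -linearZ; exact: G_exp. Qed.

Lemma vderive_expmx (X : 'M[C]_n) t :
  vderive (fun s => expmx (s *: X)) (X *m expmx (t *: X)) t.
Proof. by apply: vderive_mx => i j; exact: is_derive_expmx. Qed.

Lemma vderive_expmxN (X : 'M[C]_n) t :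
  vderive (fun s => expmx (- s *: X)) (- (X *m expmx (- t *: X))) t.
Proof. by apply: vderive_mx => i j; rewrite mxE; exact: is_derive_expmxN. Qed.

Lemma vderive_mulmx (A B : C -> 'M[C]_n) dA dB t :
  vderive A dA t -> vderive B dB t ->
  vderive (fun s => A s *m B s) (dA *m B t + A t *m dB) t.
Proof.
move=> Ad Bd; apply: vderive_mx => i j.
by apply: is_derive_mulmx => k l; exact: vderive_mx_entry.
Qed.

Lemma vderive_Ad a b t :
  vderive (fun s => Adl (expmx (s *: lam a)) b)
    (ad0 a (Adl (expmx (t *: lam a)) b)) t.
Proof.
have E s : expmx (s *: lam a) *m lam b *m expmx (- s *: lam a) =
    lam (Adl (expmx (s *: lam a)) b).
  by rewrite lam_Ad ?invmx_expmx -?scaleNr //; exact: G_expZ.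
have h := vderive_mulmx
  (vderive_mulmx (vderive_expmx (lam a) t) (vderive_cst (lam b) t))
  (vderive_expmxN (lam a) t).
have := vderive_lin (lam^-1)%VF h.
rewrite (_ : (fun s => _) = fun s => Adl (expmx (s *: lam a)) b); last first.
  by apply/funext => s; rewrite E lamK.
move/vderive_eq; apply.
rewrite (conj_derivE (lam b) (expmx (t *: lam a)) (expmx_comm (lam a) (- t))).
by rewrite (E t) -(lie_br hlam) lamK.
Qed.

(* The linear equation w' = [a, w] determines w from its initial value: conjugate
   lam w back by exp (t lam a). *)
Lemma ad_flow a (F : C -> ev) : (forall t, vderive F (ad0 a (F t)) t) ->
  F 1 = Adl (expmx (lam a)) (F 0).
Proof.
move=> Fd; pose X := lam a.
pose H s : 'M[C]_n := expmx (- s *: X) *m lam (F s) *m expmx (s *: X).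
have H1 : H 1 = H 0.
  apply: vderive0_cst => t.
  have h := vderive_mulmx (vderive_mulmx (vderive_expmxN X t)
    (vderive_lin lam (Fd t))) (vderive_expmx X t).
  apply: vderive_eq h _.
  rewrite (lie_br hlam).
  exact: conj_deriv_eq0 (expmx_comm X (- t)).
have : H 1 = lam (F 0).
  by rewrite H1 /H oppr0 !scale0r expmx0 mul1mx mulmx1.
rewrite /H scaleN1r scale1r => h.
apply: lam_inj; rewrite lam_Ad; last exact: G_exp.
rewrite -h invmx_expmx.
exact: conj_cancel (expmxNK (lam a)).
Qed.

Section Invariance.
Context (beta : 'Hom(L, 'Hom(L, C^o))) (hb : even_invariant_form g beta).
Context (rho : 'M[C]_n -> od -> od) (hrho : gauge_action G lam rho).
Local Notation w := (omega g beta).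
Local Notation k := (kappa_ev g beta).

Lemma rho_curve a x t : vderive (fun s => rho (expmx (s *: lam a)) x)
  (xi g a (rho (expmx (t *: lam a)) x)) t.
Proof. exact: (vderive_curve t (gauge_exp hrho a x)). Qed.

Lemma rho0 a x : rho (expmx (0 *: lam a)) x = x.
Proof. by rewrite scale0r expmx0 (gauge_one hrho). Qed.

(** By [dPhi_xi], the curve traced by Phi along a gauge flow line solves w' = [a, w]. *)
Lemma Phi_exp a x :
  Phi g (rho (expmx (lam a)) x) = Adl (expmx (lam a)) (Phi g x).
Proof.
pose c s := rho (expmx (s *: lam a)) x.
have c1 : c 1 = rho (expmx (lam a)) x by rewrite /c scale1r.
have c0 : c 0 = x := rho0 a x.
transitivity (Phi g (c 1)); first by rewrite c1.
transitivity (Adl (expmx (lam a)) (Phi g (c 0))); last by rewrite c0.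
apply: (ad_flow (F := fun s => Phi g (c s))) => t.
have cd := rho_curve a x t.
have := vderiveD (vderive_lin (hdif g true) cd)
  (vderive_lin (2^-1 *: \1)%VF (vderive_bil (hbr g true true) cd cd)).
rewrite (_ : (fun s => _) = fun s => Phi g (c s)); last first.
  by apply/funext => s; rewrite scale_lfunE id_lfunE.
move/vderive_eq; apply.
rewrite scale_lfunE id_lfunE (brkC _ (c t)) scale_half_double -dPhiE.
exact: dPhi_xi.
Qed.

Lemma kappa_exp c a b :
  k (Adl (expmx (lam c)) a) (Adl (expmx (lam c)) b) = k a b.
Proof.
pose f s : C^o := k (Adl (expmx (s *: lam c)) a) (Adl (expmx (s *: lam c)) b).
have : f 1 = f 0.
  apply: vderive0_cst => t.
  apply: vderive_eq (vderive_bil k (vderive_Ad c a t) (vderive_Ad c b t)) _.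
  exact: kappa_invariant.
by rewrite /f scale1r scale0r expmx0 !Ad1.
Qed.

(** In the difference of two integral curves the translation -da drops out, so increments satisfy r'
    = [a, r] and the infinitesimal invariance of omega applies. *)
Lemma omega_exp a x y z (u := expmx (lam a)) :
  w (rho u (x + y) - rho u x) (rho u (x + z) - rho u x) = w y z.
Proof.
pose r s v := rho (expmx (s *: lam a)) (x + v) - rho (expmx (s *: lam a)) x.
have rd v t : vderive (r^~ v) (hbr g false true a (r t v)) t.
  apply: vderive_eq (vderiveB (rho_curve a (x + v) t) (rho_curve a x t)) _.
  by rewrite /xi opprB addrA subrK -linearB.
have : w (r 1 y) (r 1 z) = w (r 0 y) (r 0 z).
  apply: (vderive0_cst (F := fun s => w (r s y) (r s z) : C^o)) => t.
  apply: vderive_eq (vderive_bil w (rd y t) (rd z t)) _.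
  exact: omega_invariant.
have r1 v : r 1 v = rho (expmx (lam a)) (x + v) - rho (expmx (lam a)) x.
  by rewrite /r scale1r.
have r0 v : r 0 v = v by rewrite /r !rho0 addrC addKr.
by rewrite !r1 !r0.
Qed.

Context (cG : connected G).

Lemma Phi_equivariant u x : G u -> Phi g (rho u x) = Adl u (Phi g x).
Proof.
move=> Gu; move: u Gu x.
apply: (connected_lag_ind hG cG) => [x|u X Gu IH GX x].
  by rewrite (gauge_one hrho) Ad1.
rewrite -(lamVK GX) (gauge_mul hrho) //; last exact: G_exp.
by rewrite IH Phi_exp Ad_mul //; exact: G_exp.
Qed.

Lemma kappa_Ad u a b : G u -> k (Adl u a) (Adl u b) = k a b.
Proof.
move=> Gu; move: u Gu a b.
apply: (connected_lag_ind hG cG) => [a b|u X Gu IH GX a b].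
  by rewrite !Ad1.
rewrite -(lamVK GX) !Ad_mul //; try exact: G_exp.
by rewrite IH kappa_exp.
Qed.

Lemma omega_rho u x y z : G u ->
  w (rho u (x + y) - rho u x) (rho u (x + z) - rho u x) = w y z.
Proof.
move=> Gu; move: u Gu x y z.
apply: (connected_lag_ind hG cG) => [x y z|u X Gu IH GX x y z].
  have e v : rho 1%:M (x + v) - rho 1%:M x = v.
    by rewrite !(gauge_one hrho) addrC addKr.
  by rewrite !e.
rewrite -(lamVK GX); set a := (_ X); have Ge := G_exp a.
rewrite !(gauge_mul hrho) // -[RHS](omega_exp a x y z).
(* Increments of the composite are increments of [rho u] at the moved base point, in directions
   already transported by the exponential. *)
have e v : rho (expmx (lam a)) (x + v) = rho (expmx (lam a)) x +
    (rho (expmx (lam a)) (x + v) - rho (expmx (lam a)) x) by rewrite [RHS]addrC subrK.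
rewrite [in LHS](e y) [in LHS](e z); exact: IH.
Qed.

End Invariance.

End GaugeAction.

(** * Differentials of quadratic maps *)

Section QuadraticMaps.
Context {R : realType}.
Local Notation C := (Cplx R).

Lemma normr_rV_ge m n (h : 'M[C]_(m, n)) i j : `|h i j| <= `|h|.
Proof.
have : `|h i j| <= mx_norm h; last exact.
rewrite mx_normE -[leLHS]nngE num_le.
exact: (le_bigmax _ (fun ij => `|h ij.1 ij.2|%:nng%R) (i, j)).
Qed.

(** The library norm is a complex number that happens to be real; [x] is that real, comparable with
    [nrm] up to the number of entries. *)
Lemma normr_mxE m n (h : 'M[C]_(m, n)) : exists2 x : R,
  `|h| = (x%:C)%C & 0 <= x /\ nrm h <= (m * n)%:R * x.
Proof.
have h0 : 0 <= `|h| by [].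
have hE : `|h| = ((complex.Re `|h|)%:C)%C.
  by move: h0; case: `|h| => a b; rewrite lecE /= => /andP[/eqP ->].
exists (complex.Re `|h|) => //; split; first by move: h0; rewrite hE ler0c.
rewrite natrM mulrAC -mulrA.
rewrite /nrm; apply: (@le_trans _ _ (\sum_(i < m) \sum_(j < n) complex.Re `|h|)).
  apply: ler_sum => i _; apply: ler_sum => j _.
  by have := normr_rV_ge h i j; rewrite hE normCE lecR.
rewrite !sumr_const !card_ord -mulrnA -[leLHS]mulr_natr natrM.
by rewrite le_eqVlt; apply/orP; left; apply/eqP; ring.
Qed.

Lemma is_diff_of_quadratic m n (F : 'rV[C]_m -> 'rV[C]_n) (M : 'M[C]_(m, n))
    (a : 'rV[C]_m) (K : R) : 0 <= K ->
  (forall h, nrm (F (a + h) - F a - h *m M) <= K * nrm h ^+ 2) ->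
  is_diff a F (fun h => h *m M).
Proof.
move=> K0 FK; pose D : {linear 'rV[C]_m -> 'rV[C]_n} := mulmxr M.
have Dc : continuous D.
  move=> x U /nrm_nbhs[e e0 eU].
  have q0 : 0 < nrm M + 1 by rewrite ltr_wpDl ?nrm_ge0.
  have d0 : 0 < e / (nrm M + 1) by rewrite divr_gt0.
  apply: filterS (nbhs_nrm x d0) => y /= xy; apply: eU.
  rewrite /= -mulmxBl; apply: le_lt_trans (ler_nrmM _ _) _.
  apply: (@le_lt_trans _ _ (nrm (y - x) * (nrm M + 1))).
    by rewrite ler_wpM2l ?nrm_ge0 // lerDl.
  by rewrite -ltr_pdivlMr.
have Do : F \o shift a = cst (F a) + D +o_ (0 : 'rV[C]_m) id.
  apply/eqaddoP => _ /posnumP[e]; have [d d0 eE] := pos_cplx (gt0 e).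
  pose c : R := K * (1 * m)%:R.
  have c0 : 0 <= c by rewrite mulr_ge0.
  have q0 : 0 < d / (c + 1) by rewrite divr_gt0 // ltr_wpDl.
  apply: filterS (nbhs_nrm 0 q0) => h /=; rewrite subr0 => hq.
  have [x hx [x0 nh]] := normr_mxE h.
  rewrite eE hx -[(_ * _)%R](rmorphM (real_complex R)).
  apply: le_trans (normr_le_nrm _) _; rewrite lecR.
  have -> : (F \o shift a - (cst (F a) + D)) h = F (a + h) - F a - h *m M.
    rewrite -[LHS]/(F (h + a) - (F a + h *m M)) [h + a]addrC.
    by rewrite opprD addrA.
  apply: le_trans (FK h) _.
  apply: (@le_trans _ _ (c * x * nrm h)).
    rewrite /c expr2 mulrA ler_wpM2r ?nrm_ge0 // -mulrA.
    by rewrite ler_wpM2l.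
  rewrite mulrAC; apply: ler_wpM2r => //.
  apply: (@le_trans _ _ ((c + 1) * nrm h)).
    by rewrite ler_wpM2r ?nrm_ge0 // lerDl.
  by rewrite mulrC -ler_pdivlMr ?ltW // ltr_wpDl.
have dE := diff_unique Dc Do.
apply: DiffDef; last exact: dE.
by apply/diff_locallyP; rewrite dE.
Qed.

Lemma rv_lin (V W : vectType C) (f : 'Hom(V, W)) x :
  rv (f x) = rv x *m mxof (vbasis {:V}) (vbasis {:W}) f.
Proof. by rewrite /rv (rVof_app _ (vbasisP _)). Qed.

Lemma vec_rv (V : vectType C) : cancel (@rv _ V) vec.
Proof. exact: rVofK (vbasisP _). Qed.

Lemma rv_vec (V : vectType C) : cancel (@vec _ V) rv.
Proof. exact: vecofK (vbasisP _). Qed.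

Lemma rvD (V : vectType C) (x y : V) : rv (x + y) = rv x + rv y.
Proof. exact: linearD. Qed.

Lemma vecD (V : vectType C) x y : vec (x + y) = vec x + vec y :> V.
Proof. exact: linearD. Qed.

Lemma nrm_bilin (V W : vectType C) (b : 'Hom(V, 'Hom(V, W))) :
  exists2 K : R, 0 <= K & forall x, nrm (rv (b x x)) <= K * nrm (rv x) ^+ 2.
Proof.
pose e (i : 'I_(\dim {:V})) := (vbasis {:V})`_i.
exists (\sum_i \sum_j nrm (rv (b (e i) (e j)))).
  by apply: sumr_ge0 => i _; apply: sumr_ge0 => j _; exact: nrm_ge0.
move=> x.
have uE u : u = \sum_i rv u 0 i *: e i.
  by rewrite {1}(coord_vbasis (memvf u)); apply: eq_bigr => i _; rewrite mxE.
have bE u v : rv (b u v) = \sum_i \sum_j (rv u 0 i * rv v 0 j) *: rv (b (e i) (e j)).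
  rewrite {1}(uE u) linear_sum sum_lfunE /rv linear_sum; apply: eq_bigr => i _.
  rewrite linearZ /= scale_lfunE {1}(uE v) linear_sum scaler_sumr linear_sum.
  by apply: eq_bigr => j _; rewrite !linearZ /= scalerA.
rewrite bE.
apply: le_trans (ler_nrm_sum _ _ _) _; rewrite mulr_suml; apply: ler_sum => i _.
apply: le_trans (ler_nrm_sum _ _ _) _; rewrite mulr_suml; apply: ler_sum => j _.
rewrite nrmZ mulrC ler_wpM2l ?nrm_ge0 // cabsM expr2.
by rewrite ler_pM ?cabs_ge0 ?cabs_le_nrm.
Qed.

(** The expansion is exact, with a remainder bounded by a multiple of |h|^2; [Phi], [mu] and the
    affine maps [rho u] are all of this kind. *)
Lemma has_differential_quadratic (V W : vectType C) (f : V -> W) (x : V)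
    (df : 'Hom(V, W)) (b : 'Hom(V, 'Hom(V, W))) :
  (forall h, f (x + h) = f x + df h + b h h) -> has_differential f x df.
Proof.
move=> fE; have [K K0 bK] := nrm_bilin b.
rewrite /has_differential.
have -> : (rv \o df \o vec) = fun h => h *m mxof (vbasis {:V}) (vbasis {:W}) df.
  by apply/funext => h; rewrite /= rv_lin rv_vec.
apply: (is_diff_of_quadratic K0) => h /=.
have hM : h *m mxof (vbasis {:V}) (vbasis {:W}) df = rv (df (vec h)).
  by rewrite rv_lin rv_vec.
rewrite vecD !vec_rv fE !rvD hM.
have -> (p q r : 'rV[C]_(\dim {:W})) : p + q + r - p - q = r.
  by rewrite -addrA -opprD addrAC subrr add0r.
by have := bK (vec h); rewrite rv_vec.
Qed.

Lemma has_differential_affine (V W : vectType C) (f : V -> W) (x : V)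
    (df : 'Hom(V, W)) : (forall h, f (x + h) = f x + df h) ->
  has_differential f x df.
Proof.
move=> fE; apply: (has_differential_quadratic (b := 0)) => h.
by rewrite !zero_lfunE addr0.
Qed.

End QuadraticMaps.

(** * Points of schemes under linear isomorphisms *)

Section LinearTransport.
Context {R : realType}.
Local Notation C := (Cplx R).
Local Notation alg := (comUnitAlgType C).
Local Notation mxb V W f := (mxof (vbasis {:V}) (vbasis {:W}) f).

Lemma evalA_linsub M N (B : 'M[C]_(M, N)) (A : alg) (x : 'rV[A]_M) (p : mpoly N C) :
  evalA (fun k => (x *m map_mx (in_alg A) B) 0 k) p =
  evalA (fun k => x 0 k) (comp_mpoly (linsub B) p).
Proof.
elim/(@mpoly_alg_ind R): p => [c|i|p q pd qd|p q pd qd].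
- by rewrite comp_mpolyC /evalA !mmapC.
- rewrite /comp_mpoly mmapX mmap1U /evalA mmapX mmap1U tnth_mktuple.
  rewrite raddf_sum mxE; apply: eq_bigr => l _ /=.
  by rewrite mmapZ mmapX mmap1U !mxE mulrC.
- rewrite comp_mpolyD /evalA !mmapD.
  by congr (_ + _); [exact: pd|exact: qd].
- rewrite (rmorphM (comp_mpoly (linsub B))) /evalA !rmorphM /=.
  by congr (_ * _); [exact: pd|exact: qd].
Qed.

Lemma meval_rv_lin (V W : vectType C) (f : 'Hom(V, W)) (v : V) p :
  meval (fun k => rv (f v) 0 k) p =
  meval (fun k => rv v 0 k) (comp_mpoly (linsub (mxb V W f)) p).
Proof.
rewrite comp_mpoly_meval; apply: meval_eq => k.
rewrite meval_linsub rv_lin mxE; apply: eq_bigr => l _.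
exact: mulrC.
Qed.

Lemma lin_ptsK (V W : vectType C) (f : 'Hom(V, W)) (f' : 'Hom(W, V)) :
  cancel f f' -> forall (A : alg), cancel (@lin_pts R V W f A) (@lin_pts R W V f' A).
Proof.
move=> fK A x; rewrite /lin_pts -mulmxA -map_mxM.
rewrite -(mxof_comp _ _ (vbasisP _)).
have -> : (f' \o f)%VF = \1%VF.
  by apply/lfunP => v; rewrite comp_lfunE id_lfunE fK.
by rewrite mxof1 ?map_mx1 ?mulmx1 // (basis_free (vbasisP _)).
Qed.

(** Vanishing functions are pulled back along [f], while the coefficients witnessing the unit ideal
    are pulled back along [f'], so that their values at the transported point are unchanged. *)
Lemma lc_pts_image (V W : vectType C) (f : 'Hom(V, W)) (f' : 'Hom(W, V))
    (S : set V) (A : alg) (y : apts V A) : cancel f f' -> cancel f' f ->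
  lc_pts S y -> lc_pts (f @` S) (lin_pts f y).
Proof.
move=> fK f'K [yS [s [sS s1]]].
have pull p : van_ideal S p -> van_ideal (f @` S) (comp_mpoly (linsub (mxb W V f')) p).
  by move=> Sp _ [v Sv <-]; rewrite -meval_rv_lin fK; exact: Sp.
split=> [p Sp|].
  rewrite evalA_linsub; apply: yS => v Sv; rewrite -meval_rv_lin.
  by apply: Sp; exists v.
exists [seq (c.1, comp_mpoly (linsub (mxb W V f')) c.2) | c <- s]; split.
  move=> _ /mapP[c cs ->] /= w [zw nw]; rewrite -meval_rv_lin.
  apply: (sS c cs); split.
    by move=> p Sp; rewrite meval_rv_lin; apply: zw; exact: pull.
  by move=> Sw; apply: nw; exists ((f' : W -> V) w) => //; exact: f'K.
have yE : lin_pts f y *m map_mx (in_alg A) (mxb W V f') = y := lin_ptsK fK y.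
rewrite big_map -[RHS]s1; apply: eq_bigr => c _ /=; congr (_ * _).
by rewrite -evalA_linsub yE.
Qed.

Lemma lc_pts_imageE (V W : vectType C) (f : 'Hom(V, W)) (f' : 'Hom(W, V))
    (S : set V) (A : alg) (y : apts V A) : cancel f f' -> cancel f' f ->
  lc_pts (f @` S) (lin_pts f y) <-> lc_pts S y.
Proof.
move=> fK f'K; split; last exact: lc_pts_image.
move=> /(lc_pts_image f'K fK); rewrite lin_ptsK //.
rewrite image_comp (_ : f' \o f = id) ?image_id //.
by apply/funext => v; exact: fK.
Qed.

(** A space and its dual have the same dimension, so injectivity makes the total inverse a genuine
    one. *)
Lemma dual_lker0_limg (V : vectType C) (f : 'Hom(V, 'Hom(V, C^o))) :
  lker f = 0%VS -> cancel (f^-1)%VF f.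
Proof.
move=> f0 phi; apply: limg_lfunVK.
suff -> : limg f = fullv by exact: memvf.
apply/eqP; rewrite eqEdim subvf /=.
have := limg_ker_dim f fullv; rewrite capfv f0 dimv0 add0n => ->.
by rewrite !dimvf -[leqLHS]/(dim V * 1)%N muln1.
Qed.

End LinearTransport.

(** * The moment map and the reduction *)

Section Reduction.
Context {R : realType}.
Local Notation C := (Cplx R).
Context {L : vectType C} (g : dgLieSuper L).
Local Notation ev := (hpart g false).
Local Notation od := (hpart g true).

Lemma Phi_differential (x : od) : has_differential (Phi g) x (dPhi g x).
Proof.
apply: (has_differential_quadratic (b := (2^-1 *: hbr g true true)%R)) => h.
by rewrite Phi_taylor !scale_lfunE.
Qed.

Lemma mu_differential (beta : 'Hom(L, 'Hom(L, C^o))) (x : od) :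
  has_differential (mu g beta) x (kappa_ev g beta \o dPhi g x)%VF.
Proof.
pose q (h : od) : 'Hom(od, 'Hom(ev, C^o)) :=
  (kappa_ev g beta \o (2^-1 *: hbr g true true h)%R)%VF.
have qlin : linear q.
  move=> c u v; apply/lfunP => y.
  have e : hbr g true true (c *: u + v) =
      (c *: hbr g true true u + hbr g true true v)%R := linearP _ _ _ _.
  rewrite add_lfunE scale_lfunE !comp_lfunE !scale_lfunE e add_lfunE scale_lfunE.
  rewrite scalerDr scalerA mulrC -scalerA.
  exact: (linearP (kappa_ev g beta)).
apply: (has_differential_quadratic (b := linfun q)) => h.
have qE : linfun q h h = kappa_ev g beta (2^-1 *: hbr g true true h h).
  by rewrite (linfun_lin qlin) comp_lfunE scale_lfunE.
by rewrite /mu Phi_taylor !linearD /= comp_lfunE qE.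
Qed.

(** An equality of families of sets, not a pointwise equivalence, so that it can be rewritten inside
    [stack_quotient]. *)
Lemma kappa_preimage_pts (beta : 'Hom(L, 'Hom(L, C^o))) (O : set ev) :
  lker (kappa_ev g beta) = 0%VS ->
  (fun A : comUnitAlgType C => [set x | lc_pts O (Phi_pts g A x)]) =
  (fun A => [set x | lc_pts (kappa_ev g beta @` O) (mu_pts g beta A x)]).
Proof.
move=> k0; apply: functional_extensionality_dep => A; apply/seteqP.
have kK : cancel (kappa_ev g beta) (kappa_ev g beta)^-1%VF.
  by apply: lker0_lfunK; apply/eqP.
have kVK := dual_lker0_limg k0.
by split=> x /= /(lc_pts_imageE _ _ kK kVK).
Qed.

End Reduction.
Theorem mainTheorem1 (R : realType) (L : vectType (Cplx R)) (g : dgLieSuper L)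
    (beta : 'Hom(L, 'Hom(L, (Cplx R)^o)))
    (hbeta : even_invariant_form g beta)
    (n : nat) (G : set 'M[Cplx R]_n)
    (hG : linear_algebraic_group G) (hGsc : simply_connected R G)
    (lam : 'Hom(hpart g false, 'M[Cplx R]_n)) (hlam : lie_algebra_iso G lam)
    (rho : 'M[Cplx R]_n -> hpart g true -> hpart g true)
    (hrho : gauge_action G lam rho) :
  ((lker (omega g beta) = 0%VS -> symplectic_form (omega g beta)) /\
   (forall u, G u -> symplectic_map (omega g beta) (rho u))) /\
  moment_map (omega g beta) G (Ad lam) rho (xi g) (mu g beta) /\
  (forall x : hpart g true, has_differential (Phi g) x (dPhi g x)) /\
  (forall (a : hpart g false) (x : hpart g true),
     dPhi g x (xi g a x) = hbr g false false a (Phi g x)) /\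
  (forall u (x : hpart g true), G u -> Phi g (rho u x) = Ad lam u (Phi g x)) /\
  (forall (a : hpart g false) (x y : hpart g true),
     omega g beta (xi g a x) y = beta (vsval a) (vsval (dPhi g x y))) /\
  (forall O : set (hpart g false), Ad_orbit G lam O ->
     MC g O = Phi g @^-1` O /\
     (forall u x, G u -> MC g O x -> MC g O (rho u x)) /\
     (forall (cov : coverage) (r : regular_action n (hpart g true)),
        regular_for r G rho ->
        modular_stack cov g G r O
        = hamiltonian_reduction cov G r (Phi_pts g) O) /\
     (lker (kappa_ev g beta) = 0%VS ->
        coAd_orbit G lam (kappa_ev g beta @` O) /\
        MC g O = mu g beta @^-1` (kappa_ev g beta @` O) /\
        (forall (cov : coverage) (r : regular_action n (hpart g true)),
           regular_for r G rho ->
           modular_stack cov g G r O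
           = hamiltonian_reduction cov G r (mu_pts g beta)
               (kappa_ev g beta @` O)))).
Proof.
have cG : connected G by case: hGsc.
pose k := kappa_ev g beta.
have equi := Phi_equivariant hG hlam hrho cG.
have kAd := kappa_Ad hG hlam hbeta cG.
split; first split.
- by move=> w0; split=> // x; exact: omega_alt.
- move=> u Gu x; have [A [v rE]] := gauge_affine hrho Gu.
  (* Increments are the form in which invariance of omega under the whole group is available. *)
  have AE y : A y = rho u (x + y) - rho u x.
    by rewrite !rE linearD /= opprD addrACA subrr addr0 addrC addKr.
  exists A; first by apply: has_differential_affine => h; rewrite AE [RHS]addrC subrK.
  by move=> y z; rewrite !AE; exact: (omega_rho hG hlam hbeta hrho cG).
split.
  split=> [x|u x b Gu]; last by rewrite /mu equi // kAd.
  exists (k \o dPhi g x)%VF; first exact: mu_differential.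
  by move=> a y; rewrite comp_lfunE kappa_sym // (omega_xi hbeta) kappaE.
split; first exact: Phi_differential.
split; first exact: dPhi_xi.
split; first by move=> u x Gu; exact: equi.
split; first by move=> a x y; exact: omega_xi.
move=> O [a OE]; split; first by [].
split.
  move=> u x Gu; rewrite /MC /= -!/(Phi g _) equi // OE => -[v Gv ->].
  by exists (u *m v); [exact: (lag_mul hG)|rewrite (Ad_mul hG hlam)].
(* Unfolding [Phi_pts] turns both sides into the quotient of the same functor of points. *)
split; first by [].
move=> k0; have kI : injective k by apply/lker0P/eqP.
have kVK := dual_lker0_limg k0.
split.
  exists (k a); apply/seteqP; split=> [_ [b + <-]|psi [u Gu psiE]].
    by rewrite OE => -[u Gu ->]; exists u => // c; exact: kAd.
  exists (Ad lam u a); first by rewrite OE; exists u.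
  apply/lfunP => b; have Gv := lag_inv hG Gu.
  (* The functional [psi] is known on vectors of the form [Ad lam u c] only, so its argument is
     brought to this form. *)
  have -> : b = Ad lam u (Ad lam (invmx u) b).
    by rewrite -(Ad_mul hG hlam) // mulmxV ?(lag_unit hG) // (Ad1 hG hlam).
  by rewrite psiE; exact: kAd.
split.
  apply/seteqP; split=> x; first by move=> Ox; exists (Phi g x).
  by move=> [b Ob /kI bE]; rewrite /MC /= -/(Phi g x) -bE.
move=> cov r _; rewrite /hamiltonian_reduction -(kappa_preimage_pts _ k0).
by [].
Qed.
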